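(* Let $a>b>0$ and let $\mathcal S_0=\{x_1+ix_2\in\mathbf C: x_1^2/a^2+x_2^2/b^2\leq 1\}$ be the solid ellipse with semi-axes $a,b$. Then $\mathcal S_0$ is detectable: if $(\mathbf p_1,\mathbf v_1)$ and $(\mathbf p_2,\mathbf v_2)$ are two configurations of the solid of shape $\mathcal S_0$ with $\mathbf v_1\not\equiv0$ and $\mathbf v_2\not\equiv 0$, whose complex potentials $\xi_1,\xi_2$ coincide on $\{|z|>R\}$ for some $R>0$, then $\mathbf p_1=\mathbf p_2$ (i.e. $\mathbf p_1(\mathcal S_0)=\mathbf p_2(\mathcal S_0)$) and $\mathbf v_1=\mathbf v_2$.
   Context: The plane $\mathbf R^2$ is identified with $\mathbf C$. Position: a triplet $\mathbf p=(\theta,\mathbf s,\mathbf r)\in\mathbf R/2\pi\times\mathbf C\times\mathbf C$ acting by $\mathbf p z=e^{i\theta}(z-\mathbf s)+\mathbf r$; two triplets are identified when they give the same set $\mathcal S=\mathbf p(\mathcal S_0)$. Velocity: a rigid velocity field $\mathbf v(z)=i\omega(z-\mathbf s)+w$ with $\omega\in\mathbf R$, $\mathbf s,w\in\mathbf C$; triplets $(\omega,\mathbf s,w)$ giving the same field are identified. Configuration: a pair $(\mathbf p,\mathbf v)$ consisting of a position and a velocity. Complex potential: for a configuration $(\mathbf p,\mathbf v)$, with $\mathcal S=\mathbf p(\mathcal S_0)$ and $\mathcal F=\mathbf C\setminus\mathcal S$, it is the unique holomorphic function $\xi=\varphi+i\psi$ on $\mathcal F$ with $\xi(z)\to 0$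 as $|z|\to\infty$ and satisfying the slip condition $\partial_n\varphi=\mathbf v\cdot\mathbf n$ on $\partial\mathcal S$; equivalently, $\xi$ extends continuously to $\partial\mathcal S$ and there is a real constant $C$ with $\operatorname{Im}\xi(x)=\operatorname{Im}(\bar w x)-\frac{\omega}{2}|x-\mathbf s|^2+C$ for $x\in\partial\mathcal S$. Detectability of a shape means that for any configuration (of a moving solid) the knowledge of the potential suffices to recover the position and the velocity; the potential is known through its analytic expression near infinity (its Laurent expansion), the domain $\mathcal F$ being unknown. *)

(* Defs.v *)
From Stdlib Require Import Reals.
From Coquelicot Require Import Coquelicot.

Open Scope R_scope.

(** The plane is [C]; a subset of the plane is a predicate on [C]. *)

Definition cis (t : R) : C := (cos t, sin t).

(** [theta] is a real representative of an angle in R/2pi.  Distinct triplets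
    may describe the same position; positions are compared through the set
    [moved p S0]. *)
Record position := Position { theta : R; pos_s : C; pos_r : C }.

Definition act (p : position) (z : C) : C :=
  (cis (theta p) * (z - pos_s p) + pos_r p)%C.

Definition moved (p : position) (S0 : C -> Prop) : C -> Prop :=
  fun x => exists z, S0 z /\ x = act p z.

Definition same_position (S0 : C -> Prop) (p1 p2 : position) : Prop :=
  forall x, moved p1 S0 x <-> moved p2 S0 x.

(** Distinct triplets may describe the same velocity; velocities are compared
    through the field [field v]. *)
Record velocity := Velocity { omega : R; vel_s : C; vel_w : C }.

Definition field (v : velocity) (z : C) : C :=
  (Ci * omega v * (z - vel_s v) + vel_w v)%C.

Definition same_velocity (v1 v2 : velocity) : Prop :=
  forall z, field v1 z = field v2 z.

Definition nonzero_velocity (v : velocity) : Prop :=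
  exists z, field v z <> 0%C.

Definition boundary (S : C -> Prop) (x : C) : Prop :=
  ~ locally x S /\ ~ locally x (fun y => ~ S y).

(** Differentiability here is over the field [C], not over [R]. *)
Definition holomorphic_on (D : C -> Prop) (f : C -> C) : Prop :=
  forall z, D z -> @ex_derive C_AbsRing C_NormedModule f z.

Definition vanishes_at_infinity (f : C -> C) : Prop :=
  forall eps : R, 0 < eps ->
    exists M : R, forall z, M < Cmod z -> Cmod (f z) < eps.

(** The slip condition d_n(Re xi) = v . n on the boundary of [S], integrated
    along the boundary by the Cauchy-Riemann equations into a condition on the
    stream function Im xi.  [g] is the continuous extension of [xi] to the
    boundary of [S]. *)
Definition slip_condition (S : C -> Prop) (v : velocity) (xi : C -> C) : Prop :=
  exists g : C -> C,
    (forall z, ~ S z -> g z = xi z) /\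
    continuous_on (fun z => ~ S z \/ boundary S z) g /\
    exists c : R, forall x, boundary S x ->
      Im (g x) = Im (Cconj (vel_w v) * x)%C
                 - omega v / 2 * Cmod (x - vel_s v)%C ^ 2 + c.

(** Only the values of [xi] outside the solid [moved p S0] are constrained. *)
Definition complex_potential (S0 : C -> Prop) (p : position) (v : velocity)
    (xi : C -> C) : Prop :=
  holomorphic_on (fun z => ~ moved p S0 z) xi /\
  vanishes_at_infinity xi /\
  slip_condition (moved p S0) v xi.

Definition detectable (S0 : C -> Prop) : Prop :=
  forall (p1 p2 : position) (v1 v2 : velocity) (xi1 xi2 : C -> C) (rho : R),
    nonzero_velocity v1 -> nonzero_velocity v2 ->
    complex_potential S0 p1 v1 xi1 -> complex_potential S0 p2 v2 xi2 ->
    0 < rho -> (forall z, rho < Cmod z -> xi1 z = xi2 z) ->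
    same_position S0 p1 p2 /\ same_velocity v1 v2.

Definition ellipse (a b : R) : C -> Prop :=
  fun x => Re x ^ 2 / a ^ 2 + Im x ^ 2 / b ^ 2 <= 1.

(* Main.v *)
Require Import Defs.
From Stdlib Require Import Reals Lra Lia List.
From Coquelicot Require Import Coquelicot.
Import ListNotations.

Open Scope R_scope.

(** Let the solid be the ellipse with centre c and axis direction e^{i theta}.
    The map w |-> c + e^{i theta} (alpha e^w + beta e^{-w}), with
    alpha = (a+b)/2 and beta = (a-b)/2, sends the half-plane Re w > 0 onto the
    exterior of the ellipse and the line Re w = 0 onto its boundary.  In this
    coordinate the potential is xi = A e^{-w} + B e^{-2w} with explicit A, B:
    the difference G of the two sides is holomorphic and 2 i pi-periodic on the
    half-plane, tends to 0 at the right and has constant imaginary part on the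
    line.  By Goursat's theorem, the mean over a period of such a function does
    not depend on Re w.  Applied to i G it shows that Im G = 0 on the line;
    applied to G^2, that Re G = 0 there; applied to G K^n, where K is an entire
    function equal to (1 - cos t)/2 on a given vertical line, that G = 0.

    With eta = alpha e^{i theta} e^w and kappa = alpha beta e^{2 i theta} this reads
    z = c + eta + kappa/eta and xi = A'/eta + B'/eta^2.  The function xi is a root
    of a quadratic polynomial over C[z] and is not rational (exchanging the two
    roots eta and kappa/eta fixes z but not xi), so xi determines this polynomial,
    whose coefficients determine c, kappa, A' and B'.  Finally kappa gives theta
    modulo pi, B' gives the angular velocity and A' the velocity of the centre. *)

(** * Goursat's theorem on rectangles *)

(** The integral of the form P dx + Q dy along the boundary of [a,b] x [c,d], counterclockwise. *)
Definition circulation (P Q : R -> R -> R) (a b c d : R) : R :=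
  RInt (fun x => P x c) a b - RInt (fun x => P x d) a b
  + RInt (Q b) c d - RInt (Q a) c d.

(** The common value [m] is dP/dy = dQ/dx. Only differentiability at the point is asked, since a
    complex derivative is not known beforehand to be continuous. *)
Definition closed_at (P Q : R -> R -> R) (x y : R) : Prop :=
  exists lx m ly,
    differentiable_pt_lim P x y lx m /\ differentiable_pt_lim Q x y m ly.

Lemma continuous_section_l (f : R -> R -> R) (x y : R) :
  continuity_2d_pt f x y -> continuous (fun u => f u y) x.
Proof.
  intros H; apply continuity_pt_filterlim; intros eps Heps.
  destruct (H (mkposreal eps Heps)) as [d Hd].
  exists d; split; [apply cond_pos|].
  intros u [_ Hu]; apply Hd; [exact Hu|].
  rewrite Rminus_diag, Rabs_R0; apply cond_pos.
Qed.

Lemma continuous_section_r (f : R -> R -> R) (x y : R) :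
  continuity_2d_pt f x y -> continuous (f x) y.
Proof.
  intros H; apply continuity_pt_filterlim; intros eps Heps.
  destruct (H (mkposreal eps Heps)) as [d Hd].
  exists d; split; [apply cond_pos|].
  intros u [_ Hu]; apply Hd; [|exact Hu].
  rewrite Rminus_diag, Rabs_R0; apply cond_pos.
Qed.

Lemma differentiable_pt_lim_continuity (f : R -> R -> R) (x y lx ly : R) :
  differentiable_pt_lim f x y lx ly -> continuity_2d_pt f x y.
Proof.
  intros H; apply differentiable_continuity_pt; exists lx, ly; exact H.
Qed.

Lemma RInt_abs_le (f : R -> R) (a b M : R) :
  a <= b -> ex_RInt f a b -> (forall x, a <= x <= b -> Rabs (f x) <= M) ->
  Rabs (RInt f a b) <= (b - a) * M.
Proof.
  intros Hab Hf HM.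
  exact (norm_RInt_le_const (V := R_NormedModule) f a b _ M Hab HM
           (RInt_correct f a b Hf)).
Qed.

Lemma RInt_Rminus (f g : R -> R) (a b : R) :
  ex_RInt f a b -> ex_RInt g a b ->
  RInt (fun x => f x - g x) a b = RInt f a b - RInt g a b.
Proof. exact (RInt_minus (V := R_CompleteNormedModule) f g a b). Qed.

Lemma RInt_Rconst (a b k : R) : RInt (fun _ => k) a b = (b - a) * k.
Proof. exact (RInt_const (V := R_CompleteNormedModule) a b k). Qed.

Lemma RInt_Rext (f g : R -> R) (a b : R) :
  a <= b -> (forall x, a < x < b -> f x = g x) -> RInt f a b = RInt g a b.
Proof.
  intros Hab H; apply RInt_ext; intros x; rewrite Rmin_left, Rmax_right by exact Hab.
  apply H.
Qed.

Section Rectangle.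

Variables (P Q : R -> R -> R) (a b c d : R).
Hypothesis closed : forall x y, a <= x <= b -> c <= y <= d -> closed_at P Q x y.

Lemma ex_RInt_horizontal (u v y : R) :
  a <= u <= b -> a <= v <= b -> c <= y <= d -> ex_RInt (fun x => P x y) u v.
Proof.
  intros Hu Hv Hy; apply (ex_RInt_continuous (V := R_CompleteNormedModule)).
  intros z Hz; apply continuous_section_l.
  assert (a <= z <= b)
    by (revert Hz; unfold Rmin, Rmax; destruct (Rle_dec u v); lra).
  destruct (closed z y) as (lx & m & ly & HP & _); [assumption|assumption|].
  exact (differentiable_pt_lim_continuity _ _ _ _ _ HP).
Qed.

Lemma ex_RInt_vertical (x u v : R) :
  a <= x <= b -> c <= u <= d -> c <= v <= d -> ex_RInt (Q x) u v.
Proof.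
  intros Hx Hu Hv; apply (ex_RInt_continuous (V := R_CompleteNormedModule)).
  intros z Hz; apply continuous_section_r.
  assert (c <= z <= d)
    by (revert Hz; unfold Rmin, Rmax; destruct (Rle_dec u v); lra).
  destruct (closed x z) as (lx & m & ly & _ & HQ); [assumption|assumption|].
  exact (differentiable_pt_lim_continuity _ _ _ _ _ HQ).
Qed.

Lemma circulation_split (x1 x2 x3 y1 y2 y3 : R) :
  a <= x1 -> x1 <= x2 -> x2 <= x3 -> x3 <= b ->
  c <= y1 -> y1 <= y2 -> y2 <= y3 -> y3 <= d ->
  circulation P Q x1 x3 y1 y3 =
    circulation P Q x1 x2 y1 y2 + circulation P Q x2 x3 y1 y2
    + circulation P Q x1 x2 y2 y3 + circulation P Q x2 x3 y2 y3.
Proof.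
  intros; unfold circulation.
  assert (HH : forall y, c <= y <= d ->
    RInt (fun x => P x y) x1 x3
    = RInt (fun x => P x y) x1 x2 + RInt (fun x => P x y) x2 x3).
  { intros y Hy; symmetry; apply (RInt_Chasles (V := R_CompleteNormedModule));
      apply ex_RInt_horizontal; lra. }
  assert (HV : forall x, a <= x <= b ->
    RInt (Q x) y1 y3 = RInt (Q x) y1 y2 + RInt (Q x) y2 y3).
  { intros x Hx; symmetry; apply (RInt_Chasles (V := R_CompleteNormedModule));
      apply ex_RInt_vertical; lra. }
  rewrite (HH y1), (HH y3), (HV x1), (HV x3) by lra; ring.
Qed.

(** The affine part of P dx + Q dy at (x0, y0) is closed and contributes nothing; on each of the
    four sides, of length at most L, the remainder is at most eps * L. *)
Lemma circulation_local (eps x0 y0 : R) :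
  0 < eps -> a <= x0 <= b -> c <= y0 <= d ->
  exists delta, 0 < delta /\ forall x1 x2 y1 y2 L,
    a <= x1 <= x0 -> x0 <= x2 <= b -> c <= y1 <= y0 -> y0 <= y2 <= d ->
    x2 - x1 <= L -> y2 - y1 <= L -> L < delta ->
    Rabs (circulation P Q x1 x2 y1 y2) <= 4 * eps * L ^ 2.
Proof.
  intros Heps Hx0 Hy0.
  destruct (closed x0 y0) as (lx & m & ly & HP & HQ); [assumption|assumption|].
  destruct (HP (mkposreal eps Heps)) as [d1 Hd1].
  destruct (HQ (mkposreal eps Heps)) as [d2 Hd2].
  simpl in Hd1, Hd2.
  exists (Rmin d1 d2); split.
  { apply Rmin_pos; apply cond_pos. }
  intros x1 x2 y1 y2 L Hx1 Hx2 Hy1 Hy2 HLx HLy HL.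
  assert (HL1 : L < d1) by (apply (Rlt_le_trans _ _ _ HL), Rmin_l).
  assert (HL2 : L < d2) by (apply (Rlt_le_trans _ _ _ HL), Rmin_r).
  assert (EP : forall x y, x1 <= x <= x2 -> y1 <= y <= y2 ->
    Rabs (P x y - P x0 y0 - (lx * (x - x0) + m * (y - y0))) <= eps * L).
  { intros x y Hx Hy.
    assert (Rabs (x - x0) <= L) by (apply Rabs_le; lra).
    assert (Rabs (y - y0) <= L) by (apply Rabs_le; lra).
    eapply Rle_trans; [apply Hd1; lra|].
    apply Rmult_le_compat_l; [lra|]. apply Rmax_lub; lra. }
  assert (EQ : forall x y, x1 <= x <= x2 -> y1 <= y <= y2 ->
    Rabs (Q x y - Q x0 y0 - (m * (x - x0) + ly * (y - y0))) <= eps * L).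
  { intros x y Hx Hy.
    assert (Rabs (x - x0) <= L) by (apply Rabs_le; lra).
    assert (Rabs (y - y0) <= L) by (apply Rabs_le; lra).
    eapply Rle_trans; [apply Hd2; lra|].
    apply Rmult_le_compat_l; [lra|]. apply Rmax_lub; lra. }
  assert (IH : forall y, c <= y <= d -> ex_RInt (fun x => P x y) x1 x2)
    by (intros; apply ex_RInt_horizontal; lra).
  assert (IV : forall x, a <= x <= b -> ex_RInt (Q x) y1 y2)
    by (intros; apply ex_RInt_vertical; lra).
  (* Opposite sides are paired. The terms in [lx] and [ly] drop out of the differences, and the two
     constants subtracted here, both multiples of [m], cancel after integration. *)
  assert (E : circulation P Q x1 x2 y1 y2 =
     RInt (fun x => P x y1 - P x y2 - m * (y1 - y2)) x1 x2
   + RInt (fun y => Q x2 y - Q x1 y - m * (x2 - x1)) y1 y2).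
  { unfold circulation.
    assert (HH : forall u v k, ex_RInt u x1 x2 -> ex_RInt v x1 x2 ->
      RInt (fun x => u x - v x - k) x1 x2 = RInt u x1 x2 - RInt v x1 x2 - (x2 - x1) * k).
    { intros; rewrite RInt_Rminus, RInt_Rminus, RInt_Rconst; auto.
      - apply (ex_RInt_minus (V := R_NormedModule) u v); assumption.
      - apply ex_RInt_const. }
    assert (HV : forall u v k, ex_RInt u y1 y2 -> ex_RInt v y1 y2 ->
      RInt (fun x => u x - v x - k) y1 y2 = RInt u y1 y2 - RInt v y1 y2 - (y2 - y1) * k).
    { intros; rewrite RInt_Rminus, RInt_Rminus, RInt_Rconst; auto.
      - apply (ex_RInt_minus (V := R_NormedModule) u v); assumption.
      - apply ex_RInt_const. }
    rewrite HH, HV; try (apply IH; lra); try (apply IV; lra); ring. }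
  rewrite E.
  eapply Rle_trans; [apply Rabs_triang|].
  replace (4 * eps * L ^ 2) with (L * (2 * (eps * L)) + L * (2 * (eps * L))) by ring.
  assert (0 <= L) by lra.
  assert (0 <= 2 * (eps * L)) by nra.
  apply Rplus_le_compat.
  - eapply Rle_trans; [apply RInt_abs_le with (M := 2 * (eps * L)); [lra| |]|].
    + apply (ex_RInt_minus (V := R_NormedModule) (fun x => P x y1 - P x y2));
        [|apply ex_RInt_const].
      apply (ex_RInt_minus (V := R_NormedModule)); apply IH; lra.
    + intros x Hx.
      assert (A1 := EP x y1 Hx ltac:(lra)). assert (A2 := EP x y2 Hx ltac:(lra)).
      apply Rabs_le_between in A1, A2. apply Rabs_le; lra.
    + apply Rmult_le_compat_r; lra.
  - eapply Rle_trans; [apply RInt_abs_le with (M := 2 * (eps * L)); [lra| |]|].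
    + apply (ex_RInt_minus (V := R_NormedModule) (fun y => Q x2 y - Q x1 y));
        [|apply ex_RInt_const].
      apply (ex_RInt_minus (V := R_NormedModule)); apply IV; lra.
    + intros y Hy.
      assert (A1 := EQ x1 y ltac:(lra) Hy). assert (A2 := EQ x2 y ltac:(lra) Hy).
      apply Rabs_le_between in A1, A2. apply Rabs_le; lra.
    + apply Rmult_le_compat_r; lra.
Qed.

(** * Bisection of the rectangle *)

Hypotheses (Hab : a <= b) (Hcd : c <= d).

Let cell (n : nat) (p : R * R) : R :=
  Rabs (circulation P Q (fst p) (fst p + (b - a) / 2 ^ n)
          (snd p) (snd p + (d - c) / 2 ^ n)).

(** Moves to the corner of a quarter carrying at least one fourth of the circulation. The last
    quarter is the default: when the other three fail the test, the triangle inequality forces it to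
    pass. *)
Let step (n : nat) (p : R * R) : R * R :=
  let x := fst p in let y := snd p in
  let x' := x + (b - a) / 2 ^ S n in let y' := y + (d - c) / 2 ^ S n in
  if Rle_dec (cell n p / 4) (cell (S n) (x, y)) then (x, y) else
  if Rle_dec (cell n p / 4) (cell (S n) (x', y)) then (x', y) else
  if Rle_dec (cell n p / 4) (cell (S n) (x, y')) then (x, y') else (x', y').

Let corner : nat -> R * R := nat_rect (fun _ => (R * R)%type) (a, c) step.

Let halving (l : R) (n : nat) : l / 2 ^ n = 2 * (l / 2 ^ S n).
Proof. simpl; field; apply pow_nonzero; lra. Qed.

Let side_ge0 (l : R) (n : nat) : 0 <= l -> 0 <= l / 2 ^ n.
Proof. intros; apply Rdiv_le_0_compat; [lra|apply pow_lt; lra]. Qed.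

Let corner_step (n : nat) (p : R * R) :
  fst p <= fst (step n p) <= fst p + (b - a) / 2 ^ S n /\
  snd p <= snd (step n p) <= snd p + (d - c) / 2 ^ S n.
Proof.
  assert (H1 := side_ge0 (b - a) (S n) ltac:(lra)).
  assert (H2 := side_ge0 (d - c) (S n) ltac:(lra)).
  unfold step; repeat destruct Rle_dec; cbn [fst snd]; lra.
Qed.

Let corner_bounds (n : nat) :
  a <= fst (corner n) /\ fst (corner n) + (b - a) / 2 ^ n <= b /\
  c <= snd (corner n) /\ snd (corner n) + (d - c) / 2 ^ n <= d.
Proof.
  induction n as [|n IH].
  - simpl; lra.
  - change (corner (S n)) with (step n (corner n)).
    assert (H := corner_step n (corner n)).
    rewrite (halving (b - a) n), (halving (d - c) n) in IH; lra.
Qed.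

Let corner_cell (n : nat) : cell 0 (corner 0) / 4 ^ n <= cell n (corner n).
Proof.
  induction n as [|n IH].
  - simpl; lra.
  - change (corner (S n)) with (step n (corner n)).
    replace (cell 0 (corner 0) / 4 ^ S n) with (cell 0 (corner 0) / 4 ^ n / 4)
      by (simpl; field; apply pow_nonzero; lra).
    enough (cell n (corner n) / 4 <= cell (S n) (step n (corner n))) by lra.
    unfold step.
    destruct Rle_dec as [|N1]; [assumption|].
    destruct Rle_dec as [|N2]; [assumption|].
    destruct Rle_dec as [|N3]; [assumption|].
    set (p := corner n) in *.
    set (hx := (b - a) / 2 ^ S n) in *; set (hy := (d - c) / 2 ^ S n) in *.
    assert (Hx0 : 0 <= hx) by (apply side_ge0; lra).
    assert (Hy0 : 0 <= hy) by (apply side_ge0; lra).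
    destruct (corner_bounds n) as (B1 & B2 & B3 & B4).
    fold p in B1, B2, B3, B4.
    assert (Ex := halving (b - a) n); fold hx in Ex.
    assert (Ey := halving (d - c) n); fold hy in Ey.
    assert (E := circulation_split (fst p) (fst p + hx) (fst p + hx + hx)
              (snd p) (snd p + hy) (snd p + hy + hy)
              ltac:(lra) ltac:(lra) ltac:(lra) ltac:(lra)
              ltac:(lra) ltac:(lra) ltac:(lra) ltac:(lra)).
    revert N1 N2 N3; unfold cell; cbn [fst snd].
    fold hx hy. rewrite Ex, Ey.
    replace (fst p + 2 * hx) with (fst p + hx + hx) by ring.
    replace (snd p + 2 * hy) with (snd p + hy + hy) by ring.
    rewrite E.
    match goal with |- context [Rabs (?A + ?B + ?C + ?D)] =>
      generalize A, B, C, D end.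
    intros A B C D.
    assert (T1 := Rabs_triang (A + B + C) D).
    assert (T2 := Rabs_triang (A + B) C).
    assert (T3 := Rabs_triang A B).
    lra.
Qed.

(** Nested intervals: lower ends increase and upper ends decrease, so the supremum of the lower ends
    lies in all of them. The coordinate [f] stands for [fst] and [snd] alike. *)
Let corner_mono (f : R * R -> R) (l : R) :
  (forall n p, f p <= f (step n p) <= f p + l / 2 ^ S n) ->
  exists X, forall n, f (corner n) <= X <= f (corner n) + l / 2 ^ n.
Proof.
  intros Hf.
  assert (up : forall n k, f (corner n) <= f (corner (k + n))).
  { intros n k; induction k as [|k IHk]; [apply Rle_refl|].
    apply (Rle_trans _ _ _ IHk), Hf. }
  assert (down : forall n k,
    f (corner (k + n)) + l / 2 ^ (k + n) <= f (corner n) + l / 2 ^ n).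
  { intros n k; induction k as [|k IHk]; [apply Rle_refl|].
    apply Rle_trans with (2 := IHk); change (S k + n)%nat with (S (k + n)).
    rewrite (halving l (k + n)).
    assert (H := Hf (k + n)%nat (corner (k + n))).
    change (corner (S (k + n))) with (step (k + n) (corner (k + n))); lra. }
  assert (l0 : forall n, 0 <= l / 2 ^ n).
  { intros n; assert (H := Hf n (corner n)).
    rewrite (halving l n); lra. }
  assert (cross : forall m n, f (corner m) <= f (corner n) + l / 2 ^ n).
  { intros m n; destruct (Nat.le_ge_cases n m) as [H|H].
    - replace m with ((m - n) + n)%nat by lia.
      assert (D := down n (m - n)%nat); assert (L := l0 ((m - n) + n)%nat); lra.
    - replace n with ((n - m) + m)%nat by lia.
      assert (U := up m (n - m)%nat); assert (L := l0 ((n - m) + m)%nat); lra. }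
  destruct (completeness (fun x => exists n, x = f (corner n))) as [X [H1 H2]].
  - exists (f (corner 0) + l / 2 ^ 0); intros x [n ->]; apply cross.
  - exists (f (corner 0)), 0%nat; reflexivity.
  - exists X; intros n; split.
    + apply H1; exists n; reflexivity.
    + apply H2; intros x [m ->]; apply cross.
Qed.

(** The n-th selected cell carries at least 4^-n of the circulation, yet near the limit point (X, Y)
    it carries at most a small multiple of its squared size, which also decreases like 4^-n. *)
Theorem goursat : circulation P Q a b c d = 0.
Proof.
  destruct (corner_mono fst (b - a)) as [X HX]; [intros; apply corner_step|].
  destruct (corner_mono snd (d - c)) as [Y HY]; [intros; apply corner_step|].
  set (L := (b - a) + (d - c)).
  apply Rabs_eq_0, Rle_antisym; [|apply Rabs_pos].
  assert (E0 : Rabs (circulation P Q a b c d) = cell 0 (corner 0)).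
  { unfold cell; simpl; repeat f_equal; field. }
  rewrite E0.
  apply le_epsilon; intros eps Heps; rewrite Rplus_0_l.
  (* With this tolerance the final bound is eps * (L^2 / (L^2 + 1)); the summand 1 keeps the
     denominator positive for a degenerate rectangle. *)
  assert (He : 0 < eps / (4 * (L ^ 2 + 1))).
  { apply Rdiv_lt_0_compat; [lra|]. assert (0 <= L ^ 2) by apply pow2_ge_0; lra. }
  assert (C0 := corner_bounds 0); assert (X0 := HX 0%nat); assert (Y0 := HY 0%nat).
  simpl in C0, X0, Y0.
  destruct (circulation_local _ X Y He) as (delta & Hdelta & Hloc); [lra|lra|].
  destruct (pow_lt_1_zero (/ 2) ltac:(rewrite Rabs_pos_eq; lra)
              (delta / (L + 1))) as [N HN].
  { apply Rdiv_lt_0_compat; [lra|unfold L; lra]. }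
  specialize (HN N ltac:(lia)).
  rewrite Rabs_pos_eq in HN by (apply pow_le; lra).
  assert (p2 : 0 < 2 ^ N) by (apply pow_lt; lra).
  rewrite pow_inv in HN.
  assert (HL : L / 2 ^ N < delta).
  { apply Rle_lt_trans with ((L + 1) * / 2 ^ N).
    - unfold Rdiv; apply Rmult_le_compat_r; [|lra].
      apply Rlt_le, Rinv_0_lt_compat; exact p2.
    - apply Rmult_lt_compat_l with (r := L + 1) in HN; [|unfold L; lra].
      replace ((L + 1) * (delta / (L + 1))) with delta in HN; [exact HN|].
      field; unfold L; lra. }
  destruct (corner_bounds N) as (B1 & B2 & B3 & B4).
  assert (XN := HX N); assert (YN := HY N).
  assert (s1 := side_ge0 (b - a) N ltac:(lra)).
  assert (s2 := side_ge0 (d - c) N ltac:(lra)).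
  assert (ES : L / 2 ^ N = (b - a) / 2 ^ N + (d - c) / 2 ^ N)
    by (unfold L; field; lra).
  assert (K := Hloc (fst (corner N)) (fst (corner N) + (b - a) / 2 ^ N)
     (snd (corner N)) (snd (corner N) + (d - c) / 2 ^ N) (L / 2 ^ N)
     ltac:(lra) ltac:(lra) ltac:(lra) ltac:(lra) ltac:(lra) ltac:(lra) HL).
  assert (K2 := corner_cell N); unfold cell at 2 in K2.
  assert (K3 := Rle_trans _ _ _ K2 K).
  assert (p4 : 0 < 4 ^ N) by (apply pow_lt; lra).
  apply Rmult_le_compat_r with (r := 4 ^ N) in K3; [|lra].
  replace (cell 0 (corner 0) / 4 ^ N * 4 ^ N) with (cell 0 (corner 0)) in K3
    by (field; lra).
  apply (Rle_trans _ _ _ K3).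
  replace ((L / 2 ^ N) ^ 2) with (L ^ 2 / 4 ^ N).
  2: { replace 4 with (2 * 2) by ring. rewrite Rpow_mult_distr. field; lra. }
  assert (0 <= L ^ 2) by apply pow2_ge_0.
  replace (4 * (eps / (4 * (L ^ 2 + 1))) * (L ^ 2 / 4 ^ N) * 4 ^ N)
    with (eps * (L ^ 2 / (L ^ 2 + 1))) by (field; lra).
  rewrite <- (Rmult_1_r eps) at 2; apply Rmult_le_compat_l; [lra|].
  apply Rle_div_l; lra.
Qed.

End Rectangle.

(** * Complex differentiability and the complex exponential *)

Definition is_C_derive (f : C -> C) (z l : C) : Prop :=
  @is_derive C_AbsRing (AbsRing_NormedModule C_AbsRing) f z l.

Definition C_derivable (f : C -> C) (z : C) : Prop := exists l, is_C_derive f z l.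

(* The two normed-module structures on [C] have the same norm but different
   uniform structures, so their derivatives agree only up to unfolding. *)
Lemma ex_derive_C_derivable (f : C -> C) (z : C) :
  @ex_derive C_AbsRing C_NormedModule f z -> C_derivable f z.
Proof.
  intros [l [[H1 H2 H3] H4]]; exists l; split; [split; assumption|exact H4].
Qed.

Lemma is_C_derive_epsilon (f : C -> C) (z l : C) :
  is_C_derive f z l <->
  forall eps, 0 < eps -> exists delta, 0 < delta /\ forall h,
    Cmod h < delta -> Cmod (f (z + h) - f z - h * l)%C <= eps * Cmod h.
Proof.
  split.
  - intros [_ H] eps Heps.
    destruct (H z (fun P HP => HP) (mkposreal eps Heps)) as [d Hd].
    exists d; split; [apply cond_pos|]; intros h Hh.
    specialize (Hd (z + h)%C).
    assert (E : minus (z + h)%C z = h) by (unfold minus, plus, opp; simpl; ring).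
    change (Cmod (minus (z + h)%C z) < d ->
       Cmod (minus (minus (f (z + h)%C) (f z)) (minus (z + h)%C z * l)%C) <=
       eps * Cmod (minus (z + h)%C z)) in Hd.
    rewrite E in Hd; exact (Hd Hh).
  - intros H; split; [apply (is_linear_scal_l (V := AbsRing_NormedModule C_AbsRing))|].
    intros x Hx eps.
    apply (is_filter_lim_locally_unique (V := AbsRing_NormedModule C_AbsRing)) in Hx.
    subst x.
    destruct (H eps (cond_pos eps)) as (d & Hd0 & Hd).
    exists (mkposreal d Hd0); intros y Hy.
    specialize (Hd (minus y z) Hy).
    replace (z + minus y z)%C with y in Hd; [exact Hd|].
    change ((y : C) = z + (y - z))%C; ring.
Qed.

Lemma is_C_derive_plus (f g : C -> C) (z l m : C) :
  is_C_derive f z l -> is_C_derive g z m ->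
  is_C_derive (fun w => f w + g w)%C z (l + m)%C.
Proof. exact (is_derive_plus (V := AbsRing_NormedModule C_AbsRing) f g z l m). Qed.

Lemma is_C_derive_mult (f g : C -> C) (z l m : C) :
  is_C_derive f z l -> is_C_derive g z m ->
  is_C_derive (fun w => f w * g w)%C z (l * g z + f z * m)%C.
Proof.
  intros Hf Hg; exact (is_derive_mult (K := C_AbsRing) f g z l m Hf Hg Cmult_comm).
Qed.

Lemma is_C_derive_comp (f g : C -> C) (z l m : C) :
  is_C_derive f (g z) l -> is_C_derive g z m ->
  is_C_derive (fun w => f (g w)) z (m * l)%C.
Proof.
  exact (is_derive_comp (V := AbsRing_NormedModule C_AbsRing) f g z l m).
Qed.

Lemma C_derivable_const (k z : C) : C_derivable (fun _ => k) z.
Proof.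
  exists 0%C; exact (is_derive_const (V := AbsRing_NormedModule C_AbsRing) k z).
Qed.

Lemma C_derivable_id (z : C) : C_derivable (fun w => w) z.
Proof. exists 1%C; exact (is_derive_id (K := C_AbsRing) z). Qed.

Lemma C_derivable_plus (f g : C -> C) (z : C) :
  C_derivable f z -> C_derivable g z -> C_derivable (fun w => f w + g w)%C z.
Proof. intros [l Hl] [m Hm]; eexists; apply is_C_derive_plus; eassumption. Qed.

Lemma C_derivable_mult (f g : C -> C) (z : C) :
  C_derivable f z -> C_derivable g z -> C_derivable (fun w => f w * g w)%C z.
Proof. intros [l Hl] [m Hm]; eexists; apply is_C_derive_mult; eassumption. Qed.

Lemma C_derivable_comp (f g : C -> C) (z : C) :
  C_derivable f (g z) -> C_derivable g z -> C_derivable (fun w => f (g w)) z.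
Proof. intros [l Hl] [m Hm]; eexists; apply is_C_derive_comp; eassumption. Qed.

Lemma Cmod_le_abs (z : C) : Cmod z <= Rabs (Re z) + Rabs (Im z).
Proof.
  assert (H1 := Rabs_pos (Re z)); assert (H2 := Rabs_pos (Im z)).
  apply Rsqr_incr_0_var; [|lra].
  rewrite !Rsqr_pow2, Cmod2_alt, <- (pow2_abs (Re z)), <- (pow2_abs (Im z)); nra.
Qed.

Lemma im_le_Cmod (z : C) : Rabs (Im z) <= Cmod z.
Proof. eapply Rle_trans; [apply Rmax_r|apply Rmax_Cmod]. Qed.

Lemma cauchy_riemann (f : C -> C) (x y : R) (l : C) :
  is_C_derive f (x, y) l ->
  differentiable_pt_lim (fun u v => Re (f (u, v))) x y (Re l) (- Im l) /\
  differentiable_pt_lim (fun u v => Im (f (u, v))) x y (Im l) (Re l).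
Proof.
  intros H; rewrite is_C_derive_epsilon in H.
  assert (K : forall eps : posreal, locally_2d (fun u v =>
     Cmod (f (u, v) - f (x, y) - ((u - x)%R, (v - y)%R) * l)%C
       <= eps * Rmax (Rabs (u - x)) (Rabs (v - y))) x y).
  (* [differentiable_pt_lim] measures increments by the maximum of the coordinates and [Cmod] is at
     most twice that, whence the halves of [eps] and [d]. *)
  { intros eps; destruct (H (eps / 2)) as (d & Hd0 & Hd).
    { apply is_pos_div_2. }
    assert (Hd2 : 0 < d / 2) by lra.
    exists (mkposreal _ Hd2); simpl; intros u v Hu Hv.
    assert (E : (u, v) = ((x, y) + ((u - x)%R, (v - y)%R))%C)
      by (unfold Cplus; simpl; f_equal; ring).
    assert (B := Cmod_le_abs (u - x, v - y)); cbn [Re Im fst snd] in B.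
    rewrite E at 1; eapply Rle_trans; [apply Hd|].
    - lra.
    - assert (M1 := Rmax_l (Rabs (u - x)) (Rabs (v - y))).
      assert (M2 := Rmax_r (Rabs (u - x)) (Rabs (v - y))).
      assert (P := cond_pos eps); nra. }
  split; intros eps; destruct (K eps) as [d Hd]; exists d; intros u v Hu Hv;
    eapply Rle_trans; try apply (Hd u v Hu Hv).
  - eapply Rle_trans; [|apply re_le_Cmod]; right; f_equal.
    unfold Cminus, Cplus, Copp, Cmult; unfold Re, Im; simpl; ring.
  - eapply Rle_trans; [|apply im_le_Cmod]; right; f_equal.
    unfold Cminus, Cplus, Copp, Cmult; unfold Re, Im; simpl; ring.
Qed.

(** * The complex exponential *)

Definition cexp (z : C) : C :=
  (exp (Re z) * cos (Im z), exp (Re z) * sin (Im z)).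

Lemma cexp_plus (z w : C) : cexp (z + w)%C = (cexp z * cexp w)%C.
Proof.
  unfold cexp, Cplus, Cmult, Re, Im; simpl; rewrite exp_plus, cos_plus, sin_plus.
  f_equal; ring.
Qed.

Lemma cexp_0 : cexp 0%C = 1%C.
Proof. unfold cexp, Re, Im; simpl; rewrite exp_0, cos_0, sin_0; apply injective_projections; simpl; ring. Qed.

Lemma Cmod_cexp (z : C) : Cmod (cexp z) = exp (Re z).
Proof.
  unfold Cmod, cexp; cbn [fst snd].
  replace (_ + _) with (exp (Re z) ^ 2).
  - apply sqrt_pow2, Rlt_le, exp_pos.
  - assert (H := sin2_cos2 (Im z)); unfold Rsqr in H.
    transitivity (exp (Re z) ^ 2 * (sin (Im z) * sin (Im z) + cos (Im z) * cos (Im z)));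
      [rewrite H|]; ring.
Qed.

Lemma cexp_neq_0 (z : C) : cexp z <> 0%C.
Proof. apply Cmod_gt_0; rewrite Cmod_cexp; apply exp_pos. Qed.

Lemma cexp_opp (z : C) : cexp (- z)%C = (/ cexp z)%C.
Proof.
  assert (H : (cexp z * cexp (- z) = 1)%C).
  { rewrite <- cexp_plus, Cplus_opp_r; apply cexp_0. }
  rewrite <- (Cmult_1_r (/ cexp z)), <- H, Cmult_assoc, Cinv_l, Cmult_1_l;
    [reflexivity|apply cexp_neq_0].
Qed.

Lemma cexp_periodic (z : C) : cexp (z + (0, 2 * PI)%R)%C = cexp z.
Proof.
  unfold cexp, Cplus, Re, Im; simpl; rewrite Rplus_0_r.
  rewrite cos_plus, sin_plus, cos_2PI, sin_2PI; f_equal; ring.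
Qed.

Lemma derivable_pt_lim_at_0 (f : R -> R) (l eps : R) :
  derivable_pt_lim f 0 l -> 0 < eps ->
  exists delta, 0 < delta /\
    forall h, Rabs h < delta -> Rabs (f h - f 0 - l * h) <= eps * Rabs h.
Proof.
  intros H Heps; destruct (H eps Heps) as [d Hd].
  exists d; split; [apply cond_pos|]; intros h Hh.
  destruct (Req_dec h 0) as [->|N].
  - rewrite Rabs_R0; replace (f 0 - f 0 - l * 0) with 0 by ring.
    rewrite Rabs_R0; lra.
  - assert (K := Hd h N Hh); rewrite Rplus_0_l in K.
    replace (f h - f 0 - l * h) with (((f h - f 0) / h - l) * h) by (field; exact N).
    rewrite Rabs_mult; apply Rmult_le_compat_r; [apply Rabs_pos|lra].
Qed.

(** The functional equation reduces the claim to an estimate of cexp h - 1 - h for small h, which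
    follows from the derivatives of exp, cos and sin at 0. *)
Lemma is_C_derive_cexp (z : C) : is_C_derive cexp z (cexp z).
Proof.
  apply is_C_derive_epsilon; intros eps Heps.
  assert (Hm : 0 < Cmod (cexp z)) by (rewrite Cmod_cexp; apply exp_pos).
  (* The 7 counts the errors: in each of the real and imaginary parts, one from exp and two from cos
     or sin, as |1 + x| <= 2; then one from the product x * y. *)
  set (e := eps / (7 * Cmod (cexp z))).
  assert (He : 0 < e) by (apply Rdiv_lt_0_compat; lra).
  destruct (derivable_pt_lim_at_0 exp 1 e) as (d1 & P1 & D1);
    [generalize (derivable_pt_lim_exp 0); rewrite exp_0; auto|exact He|].
  destruct (derivable_pt_lim_at_0 cos 0 e) as (d2 & P2 & D2);
    [generalize (derivable_pt_lim_cos 0); rewrite sin_0, Ropp_0; auto|exact He|].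
  destruct (derivable_pt_lim_at_0 sin 1 e) as (d3 & P3 & D3);
    [generalize (derivable_pt_lim_sin 0); rewrite cos_0; auto|exact He|].
  exists (Rmin (Rmin 1 e) (Rmin d1 (Rmin d2 d3))); split.
  { repeat apply Rmin_pos; lra. }
  intros h Hh.
  apply Rmin_Rgt_l in Hh; destruct Hh as [Hh1 Hh].
  apply Rmin_Rgt_l in Hh1; destruct Hh1 as [Hh1 Hhe].
  apply Rmin_Rgt_l in Hh; destruct Hh as [Hd1 Hh].
  apply Rmin_Rgt_l in Hh; destruct Hh as [Hd2 Hd3].
  replace (cexp (z + h) - cexp z - h * cexp z)%C with (cexp z * (cexp h - 1 - h))%C
    by (rewrite cexp_plus; ring).
  rewrite Cmod_mult.
  enough (Cmod (cexp h - 1 - h)%C <= 7 * e * Cmod h) as K.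
  { apply Rmult_le_compat_l with (r := Cmod (cexp z)) in K; [|lra].
    apply (Rle_trans _ _ _ K); right; unfold e; field; lra. }
  assert (Hx := re_le_Cmod h); assert (Hy := im_le_Cmod h).
  destruct h as [x y]; cbn [Re Im fst snd] in Hx, Hy.
  set (m := Cmod (x, y)) in *.
  assert (Hm0 : 0 <= m) by apply Cmod_ge_0.
  specialize (D1 x ltac:(lra)); specialize (D2 y ltac:(lra));
    specialize (D3 y ltac:(lra)).
  rewrite exp_0 in D1; rewrite cos_0 in D2; rewrite sin_0 in D3.
  eapply Rle_trans; [apply Cmod_le_abs|].
  cbn [Re Im fst snd cexp Cminus Cplus Copp RtoC].
  replace (exp x * cos y + - (1) + - x)
    with ((exp x - 1 - 1 * x) * cos y + (1 + x) * (cos y - 1 - 0 * y)) by ring.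
  replace (exp x * sin y + - 0 + - y)
    with ((exp x - 1 - 1 * x) * sin y + (1 + x) * (sin y - 0 - 1 * y) + x * y) by ring.
  assert (Bc : Rabs (cos y) <= 1) by (apply Rabs_le, COS_bound).
  assert (Bs : Rabs (sin y) <= 1) by (apply Rabs_le, SIN_bound).
  assert (B1 : Rabs (1 + x) <= 2).
  { eapply Rle_trans; [apply Rabs_triang|]; rewrite Rabs_R1; lra. }
  assert (mul : forall u v p q, Rabs u <= p -> Rabs v <= q -> Rabs (u * v) <= p * q).
  { intros; rewrite Rabs_mult; apply Rmult_le_compat; auto using Rabs_pos. }
  assert (E1 : Rabs (exp x - 1 - 1 * x) <= e * m) by (eapply Rle_trans; [exact D1|nra]).
  assert (E2 : Rabs (cos y - 1 - 0 * y) <= e * m) by (eapply Rle_trans; [exact D2|nra]).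
  assert (E3 : Rabs (sin y - 0 - 1 * y) <= e * m) by (eapply Rle_trans; [exact D3|nra]).
  assert (Exy : Rabs x <= e) by lra.
  assert (T1 := mul _ _ _ _ E1 Bc); assert (T2 := mul _ _ _ _ B1 E2).
  assert (T3 := mul _ _ _ _ E1 Bs); assert (T4 := mul _ _ _ _ B1 E3).
  assert (T5 := mul _ _ _ _ Exy Hy).
  eapply Rle_trans; [apply Rplus_le_compat; [apply Rabs_triang|]|].
  { eapply Rle_trans; [apply Rabs_triang|].
    apply Rplus_le_compat_r, Rabs_triang. }
  nra.
Qed.

Lemma C_derivable_cexp (z : C) : C_derivable cexp z.
Proof. eexists; apply is_C_derive_cexp. Qed.

Lemma C_derivable_cexp_opp (z : C) : C_derivable (fun w => cexp (- w)%C) z.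
Proof.
  apply (C_derivable_comp cexp); [apply C_derivable_cexp|].
  destruct (C_derivable_mult (fun _ => RtoC (-1)) (fun w => w) z
    (C_derivable_const _ _) (C_derivable_id _)) as [l Hl].
  exists l; refine (is_derive_ext (V := AbsRing_NormedModule C_AbsRing) _ _ _ _ _ Hl).
  intros u; change (RtoC (-1) * u = - u)%C; apply injective_projections; simpl; ring.
Qed.

(** * Periodic holomorphic functions on a half-plane *)

Lemma continuous_C_pair {U : UniformSpace} (f : U -> C) (x : U) :
  continuous (fun u => Re (f u)) x -> continuous (fun u => Im (f u)) x ->
  continuous f x.
Proof.
  intros HRe HIm P [d HP].
  assert (K1 := HRe (ball (Re (f x)) d) (locally_ball _ d)).
  assert (K2 := HIm (ball (Im (f x)) d) (locally_ball _ d)).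
  unfold filtermap in *.
  refine (filter_imp _ _ _ (filter_and _ _ K1 K2)).
  intros u [H1 H2]; apply HP; split; assumption.
Qed.

Lemma continuous_Re {U : UniformSpace} (f : U -> C) (x : U) :
  continuous f x -> continuous (fun u => Re (f u)) x.
Proof.
  intros H P [d HP].
  assert (K := H (ball (f x) d) (locally_ball (T := C_UniformSpace) _ d)).
  unfold filtermap in *; refine (filter_imp _ _ _ K).
  intros u [Hu _]; apply HP; exact Hu.
Qed.

Lemma continuous_Im {U : UniformSpace} (f : U -> C) (x : U) :
  continuous f x -> continuous (fun u => Im (f u)) x.
Proof.
  intros H P [d HP].
  assert (K := H (ball (f x) d) (locally_ball (T := C_UniformSpace) _ d)).
  unfold filtermap in *; refine (filter_imp _ _ _ K).
  intros u [_ Hu]; apply HP; exact Hu.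
Qed.

Lemma continuous_Cplus {U : UniformSpace} (f g : U -> C) (x : U) :
  continuous f x -> continuous g x -> continuous (fun u => f u + g u)%C x.
Proof.
  intros Hf Hg; apply continuous_C_pair.
  - apply (continuous_plus (V := R_NormedModule) (fun u => Re (f u)) (fun u => Re (g u)));
      apply continuous_Re; assumption.
  - apply (continuous_plus (V := R_NormedModule) (fun u => Im (f u)) (fun u => Im (g u)));
      apply continuous_Im; assumption.
Qed.

Lemma continuous_Cmult {U : UniformSpace} (f g : U -> C) (x : U) :
  continuous f x -> continuous g x -> continuous (fun u => f u * g u)%C x.
Proof.
  intros Hf Hg.
  assert (f1 := continuous_Re f x Hf); assert (f2 := continuous_Im f x Hf).
  assert (g1 := continuous_Re g x Hg); assert (g2 := continuous_Im g x Hg).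
  assert (M : forall u v : U -> R, continuous u x -> continuous v x ->
     continuous (fun t => u t * v t) x)
    by (intros u v; apply (continuous_mult (K := R_AbsRing) u v)).
  apply continuous_C_pair.
  - apply (continuous_minus (V := R_NormedModule) (fun u => Re (f u) * Re (g u))
       (fun u => Im (f u) * Im (g u))); auto.
  - apply (continuous_plus (V := R_NormedModule) (fun u => Re (f u) * Im (g u))
       (fun u => Im (f u) * Re (g u))); auto.
Qed.

Lemma C_derivable_continuous (f : C -> C) (z : C) : C_derivable f z -> continuous f z.
Proof.
  intros [l Hl]; destruct z as [x y]; destruct (cauchy_riemann f x y l Hl) as [H1 H2].
  apply differentiable_pt_lim_continuity, continuity_2d_pt_filterlim in H1, H2.
  apply continuous_C_pair.
  - refine (filterlim_ext _ _ _ H1); intros [u v]; reflexivity.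
  - refine (filterlim_ext _ _ _ H2); intros [u v]; reflexivity.
Qed.

(** * Functions continuous up to the boundary of the half-plane *)

Definition clamp (z : C) : C := (Rmax 0 (Re z), Im z).

Lemma continuous_clamp (z : C) : continuous clamp z.
Proof.
  apply continuous_C_pair; cbn [clamp Re Im fst snd].
  - apply (continuous_comp (fun w : C => Re w) (fun t => Rmax 0 t)).
    + apply continuous_Re, continuous_id.
    + apply continuity_pt_filterlim.
      apply (continuity_pt_ext (fun t => (t + Rabs t) / 2)).
      { intros t; unfold Rmax, Rabs; destruct Rle_dec, Rcase_abs; lra. }
      apply continuity_pt_mult; [apply continuity_pt_plus|apply continuity_pt_const];
        [apply continuity_pt_id|apply Rcontinuity_abs|intros ? ?; reflexivity].
  - apply continuous_Im, continuous_id.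
Qed.

(** Composition with the retraction [clamp] expresses continuity up to the line Re z = 0 as
    continuity on the whole plane, whatever the values of f on the left. *)
Record periodic_half_plane (f : C -> C) : Prop := {
  php_derivable : forall z, 0 < Re z -> C_derivable f z;
  php_periodic : forall z, 0 < Re z -> f (z + (0, 2 * PI)%R)%C = f z;
  php_continuous : forall z, continuous (fun w => f (clamp w)) z }.

Lemma php_plus (f g : C -> C) :
  periodic_half_plane f -> periodic_half_plane g ->
  periodic_half_plane (fun z => f z + g z)%C.
Proof.
  intros [f1 f2 f3] [g1 g2 g3]; split; intros z.
  - intros Hz; apply C_derivable_plus; auto.
  - intros Hz; rewrite f2, g2 by assumption; reflexivity.
  - apply (continuous_Cplus (fun w => f (clamp w)) (fun w => g (clamp w))); auto.
Qed.

Lemma php_mult (f g : C -> C) :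
  periodic_half_plane f -> periodic_half_plane g ->
  periodic_half_plane (fun z => f z * g z)%C.
Proof.
  intros [f1 f2 f3] [g1 g2 g3]; split; intros z.
  - intros Hz; apply C_derivable_mult; auto.
  - intros Hz; rewrite f2, g2 by assumption; reflexivity.
  - apply (continuous_Cmult (fun w => f (clamp w)) (fun w => g (clamp w))); auto.
Qed.

Lemma php_entire (f : C -> C) :
  (forall z, C_derivable f z) -> (forall z, f (z + (0, 2 * PI)%R)%C = f z) ->
  periodic_half_plane f.
Proof.
  intros H1 H2; split; intros z; auto.
  apply (continuous_comp clamp f); [apply continuous_clamp|].
  apply C_derivable_continuous, H1.
Qed.

Lemma php_const (k : C) : periodic_half_plane (fun _ => k).
Proof. apply php_entire; [intros; apply C_derivable_const|reflexivity]. Qed.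

(** Unnormalised, and for real parts only: imaginary parts are reached by multiplying f by a
    constant such as -i. *)
Definition mean (f : C -> C) (s : R) : R := RInt (fun t => Re (f (s, t))) 0 (2 * PI).

Lemma php_continuity_2d (f : C -> C) (x y : R) :
  periodic_half_plane f ->
  continuity_2d_pt (fun u v => Re (f (clamp (u, v)))) x y.
Proof.
  intros H; apply continuity_2d_pt_filterlim.
  assert (K := continuous_Re _ _ (php_continuous f H (x, y))).
  refine (filterlim_ext _ _ _ K); intros [u v]; reflexivity.
Qed.

Lemma clamp_id (s t : R) : 0 <= s -> clamp (s, t) = (s, t).
Proof. intros H; unfold clamp; simpl; rewrite Rmax_right; [reflexivity|exact H]. Qed.

Lemma php_section_continuous (f : C -> C) (s t : R) :
  periodic_half_plane f -> 0 <= s -> continuous (fun t => Re (f (s, t))) t.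
Proof.
  intros H Hs.
  apply continuous_ext with (f := fun t => Re (f (clamp (s, t)))).
  - intros u; rewrite clamp_id; [reflexivity|exact Hs].
  - apply (continuous_section_r (fun u v => Re (f (clamp (u, v))))), php_continuity_2d, H.
Qed.

Lemma php_ex_RInt (f : C -> C) (s a b : R) :
  periodic_half_plane f -> 0 <= s -> ex_RInt (fun t => Re (f (s, t))) a b.
Proof.
  intros H Hs; apply (ex_RInt_continuous (V := R_CompleteNormedModule)).
  intros; apply php_section_continuous; assumption.
Qed.

(** The form Im f dx + Re f dy is the imaginary part of f dz, closed by the Cauchy-Riemann
    equations. In its circulation around [s1,s2] x [0, 2 pi] the horizontal sides cancel by
    periodicity. *)
Lemma mean_interior (f : C -> C) (s1 s2 : R) :
  periodic_half_plane f -> 0 < s1 -> s1 <= s2 -> mean f s1 = mean f s2.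
Proof.
  intros H H1 H2.
  assert (G : circulation (fun u v => Im (f (u, v))) (fun u v => Re (f (u, v)))
                s1 s2 0 (2 * PI) = 0).
  { assert (P := PI_RGT_0); apply goursat; try lra.
    intros x y Hx _; destruct (php_derivable f H (x, y)) as [l Hl]; [simpl; lra|].
    destruct (cauchy_riemann f x y l Hl) as [K1 K2].
    exists (Im l), (Re l), (- Im l); split; assumption. }
  unfold circulation in G.
  rewrite (RInt_Rext (fun x => Im (f (x, 0))) (fun x => Im (f (x, 2 * PI)))) in G.
  - unfold mean; lra.
  - exact H2.
  - intros x Hx.
    rewrite <- (php_periodic f H (x, 0)) by (simpl; lra).
    do 2 f_equal; unfold Cplus; simpl; f_equal; ring.
Qed.

(** By uniform continuity on [0,s] x [0, 2 pi], the mean at a small abscissa s' is close to the mean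
    at 0, and it equals the mean at s. *)
Lemma mean_boundary (f : C -> C) (s : R) :
  periodic_half_plane f -> 0 < s -> mean f s = mean f 0.
Proof.
  intros H Hs; assert (P := PI_RGT_0).
  apply Rminus_diag_uniq, Rabs_eq_0, Rle_antisym; [|apply Rabs_pos].
  apply le_epsilon; intros eps Heps; rewrite Rplus_0_l.
  assert (He : 0 < eps / (2 * PI)) by (apply Rdiv_lt_0_compat; lra).
  destruct (uniform_continuity_2d (fun u v => Re (f (clamp (u, v)))) 0 s 0 (2 * PI)
     ltac:(intros; apply php_continuity_2d, H) (mkposreal _ He)) as [d Hd].
  set (s' := Rmin s (d / 2)).
  assert (Hd0 := cond_pos d).
  assert (Hs' : 0 < s' <= s /\ s' < d).
  { unfold s', Rmin; destruct Rle_dec; lra. }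
  rewrite <- (mean_interior f s' s) by (assumption || lra).
  unfold mean; rewrite <- RInt_Rminus by (apply php_ex_RInt; [assumption|lra]).
  replace eps with ((2 * PI - 0) * (eps / (2 * PI))) by (field; lra).
  apply RInt_abs_le; [lra| |].
  - apply (ex_RInt_minus (V := R_NormedModule)); apply php_ex_RInt; auto; lra.
  - intros t Ht.
    assert (K := Hd 0 t s' t ltac:(lra) Ht ltac:(lra) Ht).
    rewrite !clamp_id in K by lra.
    apply Rlt_le, K.
    + rewrite Rminus_0_r, Rabs_pos_eq; lra.
    + rewrite Rminus_diag, Rabs_R0; exact Hd0.
Qed.

Definition vanishes_right (f : C -> C) : Prop :=
  forall eps, 0 < eps -> exists M, forall z, M < Re z -> Cmod (f z) < eps.

(** The mean on the boundary line is also the mean far to the right, where f is uniformly small. *)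
Lemma mean_zero (f : C -> C) :
  periodic_half_plane f -> vanishes_right f -> mean f 0 = 0.
Proof.
  intros H V; assert (P := PI_RGT_0).
  apply Rabs_eq_0, Rle_antisym; [|apply Rabs_pos].
  apply le_epsilon; intros eps Heps; rewrite Rplus_0_l.
  destruct (V (eps / (2 * PI))) as [M HM]; [apply Rdiv_lt_0_compat; lra|].
  set (s := Rmax M 0 + 1).
  assert (Hs : M < s /\ 0 < s)
    by (unfold s, Rmax; destruct Rle_dec; lra).
  rewrite <- (mean_boundary f s) by (assumption || lra).
  replace eps with ((2 * PI - 0) * (eps / (2 * PI))) by (field; lra).
  apply RInt_abs_le; [lra|apply php_ex_RInt; [assumption|lra]|].
  intros t Ht; apply Rle_trans with (1 := re_le_Cmod _).
  apply Rlt_le, HM; simpl; lra.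
Qed.

(** A positive value persists, up to a factor 1/2, on an interval to the right of x, which would
    make the integral positive. *)
Lemma RInt_zero_nonneg (f : R -> R) (a b : R) :
  a < b -> (forall x, continuous f x) -> (forall x, 0 <= f x) ->
  RInt f a b = 0 -> forall x, a < x < b -> f x = 0.
Proof.
  intros Hab Hc H0 HI x Hx.
  destruct (Req_dec (f x) 0) as [|N]; [assumption|exfalso].
  assert (Hp : 0 < f x) by (assert (K := H0 x); lra).
  assert (EX : forall u v, ex_RInt f u v)
    by (intros; apply (ex_RInt_continuous (V := R_CompleteNormedModule)); auto).
  assert (C1 := Hc x); apply continuity_pt_filterlim in C1.
  destruct (C1 (f x / 2) ltac:(lra)) as (d & Hd & K).
  set (y := Rmin b (x + d / 2)).
  assert (Hy : x < y <= b /\ y <= x + d / 2)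
    by (unfold y, Rmin; destruct Rle_dec; lra).
  assert (E : RInt f a b = RInt f a x + RInt f x y + RInt f y b).
  { rewrite <- (RInt_Chasles f a y b), <- (RInt_Chasles f a x y) by auto; reflexivity. }
  assert (I1 : 0 <= RInt f a x) by (apply RInt_ge_0; auto; lra).
  assert (I3 : 0 <= RInt f y b) by (apply RInt_ge_0; auto; lra).
  assert (I2 : (y - x) * (f x / 2) <= RInt f x y).
  { rewrite <- RInt_Rconst; apply RInt_le; [lra|apply ex_RInt_const|auto|].
    intros t Ht.
    assert (K' : Rabs (f t - f x) < f x / 2).
    { apply K; split; [split; [exact I|lra]|].
      change (Rabs (t - x) < d); rewrite Rabs_pos_eq; lra. }
    apply Rabs_lt_between in K'; lra. }
  assert (0 < (y - x) * (f x / 2)) by (apply Rmult_lt_0_compat; lra).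
  lra.
Qed.

(** * Uniqueness in the half-plane *)

(** Equal to sin^2(t/2): on [0, 2 pi] it reaches its maximum 1 only at pi, so its powers concentrate
    there. *)
Definition peak (t : R) : R := (1 - cos t) / 2.

Lemma continuous_peak_pow (n : nat) (t : R) : continuous (fun t => peak t ^ n) t.
Proof.
  apply (ex_derive_continuous (K := R_AbsRing) (V := R_NormedModule)).
  unfold peak; auto_derive; exact I.
Qed.

Lemma ex_RInt_peak_pow (n : nat) (a b : R) : ex_RInt (fun t => peak t ^ n) a b.
Proof.
  apply (ex_RInt_continuous (V := R_CompleteNormedModule)).
  intros; apply continuous_peak_pow.
Qed.

Lemma peak_pos (t : R) : 0 < t < 2 * PI -> 0 < peak t.
Proof.
  intros Ht; unfold peak.
  replace t with (2 * (t / 2)) by field; rewrite cos_2a_sin.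
  assert (0 < sin (t / 2)) by (apply sin_gt_0; lra).
  nra.
Qed.

(** The function sin t * peak t ^ (n+1) vanishes at both ends of the period, and its derivative is a
    polynomial in [peak t] because cos = 1 - 2 peak. *)
Lemma peak_wallis (n : nat) :
  (2 * INR n + 3) * RInt (fun t => peak t ^ S n) 0 (2 * PI) =
  (2 * INR n + 4) * RInt (fun t => peak t ^ S (S n)) 0 (2 * PI).
Proof.
  set (F := fun t => sin t * peak t ^ S n).
  set (dF := fun t => (2 * INR n + 3) * peak t ^ S n - (2 * INR n + 4) * peak t ^ S (S n)).
  assert (D : forall t, is_derive F t (dF t)).
  { intros t; unfold F, dF.
    replace ((2 * INR n + 3) * peak t ^ S n - (2 * INR n + 4) * peak t ^ S (S n))
      with (cos t * peak t ^ S n + sin t * (INR (S n) * (sin t / 2) * peak t ^ n)).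
    - unfold peak; auto_derive; [exact I|].
      change (match n with 0%nat => 1 | S _ => INR n + 1 end) with (INR (S n));
      change ((1 + - cos t) * / 2) with ((1 - cos t) / 2); simpl pow; simpl Nat.pred.
      generalize (((1 - cos t) / 2) ^ n) (INR (S n)); intros; field.
    - replace (sin t * (INR (S n) * (sin t / 2) * peak t ^ n))
        with (INR (S n) * (Rsqr (sin t)) / 2 * peak t ^ n) by (unfold Rsqr; field).
      rewrite sin2, S_INR; unfold Rsqr.
      replace (cos t) with (1 - 2 * peak t) by (unfold peak; field).
      simpl; field. }
  assert (C : forall t, continuous dF t).
  { intros t; unfold dF.
    apply (continuous_minus (V := R_NormedModule) (fun t => (2 * INR n + 3) * peak t ^ S n));
      apply (continuous_scal_r (V := R_NormedModule)); apply continuous_peak_pow. }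
  assert (I := is_RInt_derive F dF 0 (2 * PI) (fun t _ => D t) (fun t _ => C t)).
  apply is_RInt_unique in I; unfold dF in I.
  rewrite RInt_Rminus in I.
  - rewrite !(RInt_scal (V := R_CompleteNormedModule)) in I by apply ex_RInt_peak_pow.
    unfold F in I; rewrite sin_0, sin_2PI in I.
    unfold minus, plus, opp, scal in I; simpl in I; unfold mult in I; simpl in I.
    simpl; lra.
  - apply (ex_RInt_scal (V := R_NormedModule)), ex_RInt_peak_pow.
  - apply (ex_RInt_scal (V := R_NormedModule)), ex_RInt_peak_pow.
Qed.

Lemma peak_separation (d : R) : 0 < d -> exists kappa, 0 < kappa /\
  forall t, 0 <= t <= 2 * PI -> d <= Rabs (t - PI) -> kappa <= 1 - peak t.
Proof.
  intros Hd; assert (P := PI_RGT_0).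
  (* The cap at pi keeps e in the interval where cos decreases. *)
  set (e := Rmin d PI).
  assert (He : 0 < e <= PI /\ e <= d) by (unfold e, Rmin; destruct Rle_dec; lra).
  exists ((1 - cos e) / 2); split.
  - assert (cos e < cos 0) by (apply cos_decreasing_1; lra).
    rewrite cos_0 in *; lra.
  - intros t Ht Hdt; unfold peak.
    assert (Ha : Rabs (t - PI) <= PI) by (apply Rabs_le; lra).
    assert (Hc : cos (Rabs (t - PI)) <= cos e) by (apply cos_decr_1; lra).
    assert (E : cos (Rabs (t - PI)) = - cos t).
    { transitivity (cos (t - PI)).
      - unfold Rabs; destruct Rcase_abs; [apply cos_neg|reflexivity].
      - rewrite cos_minus, cos_PI, sin_PI; ring. }
    lra.
Qed.

(** If eta = f(pi)/2 were positive, f would dominate eta - M (1 - peak) on the period for some M.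
    Integrating against peak^(n+1) and using the Wallis ratio (2n+3)/(2n+4) gives eta (2n+4) <= M
    for all n, which is absurd. *)
Lemma peak_moments_le (f : R -> R) :
  (forall t, continuous f t) ->
  (forall n, RInt (fun t => f t * peak t ^ n) 0 (2 * PI) = 0) -> f PI <= 0.
Proof.
  intros Hc H0; apply Rnot_lt_le; intros Hp; assert (P := PI_RGT_0).
  assert (C1 := Hc PI); apply continuity_pt_filterlim in C1.
  destruct (C1 (f PI / 2) ltac:(lra)) as (d & Hd & K).
  set (eta := f PI / 2) in *.
  destruct (peak_separation d Hd) as (kappa & Hk & Hsep).
  destruct (continuity_ab_min f 0 (2 * PI)) as (tm & Hmin & _); [lra| |].
  { intros; apply continuity_pt_filterlim, Hc. }
  (* With this M the minorant eta - M (1 - peak t) is at most the minimum [f tm] away from pi, and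
     near pi it is at most eta < f t. *)
  set (M := Rabs (eta - f tm) / kappa).
  assert (HM0 : 0 <= M) by (apply Rdiv_le_0_compat; [apply Rabs_pos|exact Hk]).
  assert (Hp1 : forall t, peak t <= 1)
    by (intros t; unfold peak; assert (H := COS_bound t); lra).
  assert (lower : forall t, 0 <= t <= 2 * PI -> eta - M * (1 - peak t) <= f t).
  { intros t Ht; destruct (Rlt_le_dec (Rabs (t - PI)) d) as [Hn|Hf].
    - assert (eta < f t).
      { destruct (Req_dec t PI) as [->|N]; [unfold eta; lra|].
        assert (K' : Rabs (f t - f PI) < eta)
          by (apply K; repeat split; [intros E; apply N; symmetry; exact E|exact Hn]).
        apply Rabs_lt_between in K'; unfold eta in *; lra. }
      specialize (Hp1 t); nra.
    - specialize (Hsep t Ht Hf).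
      assert (M * kappa = Rabs (eta - f tm)) by (unfold M; field; lra).
      assert (eta - f tm <= Rabs (eta - f tm)) by apply Rle_abs.
      specialize (Hmin t Ht); nra. }
  set (I := fun n => RInt (fun t => peak t ^ n) 0 (2 * PI)).
  assert (Ipos : forall n, 0 < I n).
  { intros n; apply RInt_gt_0; [lra| |].
    - intros t Ht; apply pow_lt, peak_pos, Ht.
    - intros; apply continuous_peak_pow. }
  assert (bound : forall n, eta * (2 * INR n + 4) <= M).
  { intros n.
    assert (W := peak_wallis n); fold (I (S n)) (I (S (S n))) in W.
    assert (L : (eta - M) * I (S n) + M * I (S (S n)) <= 0).
    { rewrite <- (H0 (S n)).
      replace ((eta - M) * I (S n) + M * I (S (S n))) with
        (RInt (fun t => (eta - M) * peak t ^ S n - (- M) * peak t ^ S (S n)) 0 (2 * PI)).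
      - apply RInt_le; [lra| | |].
        + apply (ex_RInt_minus (V := R_NormedModule) (fun t => (eta - M) * peak t ^ S n));
            apply (ex_RInt_scal (V := R_NormedModule)), ex_RInt_peak_pow.
        + apply (ex_RInt_continuous (V := R_CompleteNormedModule)); intros.
          apply (continuous_mult (K := R_AbsRing)); [apply Hc|apply continuous_peak_pow].
        + intros t Ht; specialize (lower t ltac:(lra)).
          assert (Q : 0 < peak t ^ S n) by (apply pow_lt, peak_pos; lra).
          replace (_ - _) with ((eta - M * (1 - peak t)) * peak t ^ S n) by (simpl; ring).
          apply Rmult_le_compat_r; lra.
      - rewrite RInt_Rminus;
          try (apply (ex_RInt_scal (V := R_NormedModule)), ex_RInt_peak_pow).
        rewrite !(RInt_scal (V := R_CompleteNormedModule)) by apply ex_RInt_peak_pow.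
        unfold I, scal; simpl; unfold mult; simpl; ring. }
    assert (n0 := pos_INR n); specialize (Ipos (S n)).
    assert (E : (2 * INR n + 4) * ((eta - M) * I (S n) + M * I (S (S n)))
       = I (S n) * (eta * (2 * INR n + 4) - M)).
    { transitivity ((2 * INR n + 4) * (eta - M) * I (S n)
         + M * ((2 * INR n + 4) * I (S (S n)))); [ring|].
      rewrite <- W; ring. }
    assert (I (S n) * (eta * (2 * INR n + 4) - M) <= 0).
    { rewrite <- E. nra. }
    nra. }
  destruct (INR_archimed eta M) as [n Hn]; [unfold eta; lra|].
  specialize (bound n); assert (n0 := pos_INR n); unfold eta in *; nra.
Qed.

Lemma peak_moments (f : R -> R) :
  (forall t, continuous f t) ->
  (forall n, RInt (fun t => f t * peak t ^ n) 0 (2 * PI) = 0) -> f PI = 0.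
Proof.
  intros Hc H0; apply Rle_antisym; [apply peak_moments_le; assumption|].
  enough (- f PI <= 0) by lra.
  apply (peak_moments_le (fun t => - f t)).
  - intros t; apply (continuous_opp (V := R_NormedModule)), Hc.
  - intros n; rewrite (RInt_Rext _ (fun t => (-1) * (f t * peak t ^ n)));
      [|assert (P := PI_RGT_0); lra|intros; ring].
    rewrite (RInt_scal (V := R_CompleteNormedModule)), H0.
    + unfold scal; simpl; unfold mult; simpl; ring.
    + apply (ex_RInt_continuous (V := R_CompleteNormedModule)); intros.
      apply (continuous_mult (K := R_AbsRing)); [apply Hc|apply continuous_peak_pow].
Qed.

(** This is (1 - cosh(z - s))/2, the entire 2 i pi-periodic function that restricts to [peak] on Re
    z = s. *)
Definition peak_ext (s : R) (z : C) : C :=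
  (RtoC (1 / 2) + RtoC (- 1 / 4) * (cexp (z + RtoC (- s)) + cexp (RtoC (-1) * z + RtoC s)))%C.

Lemma peak_ext_php (s : R) : periodic_half_plane (peak_ext s).
Proof.
  apply php_entire; intros z; unfold peak_ext.
  - apply C_derivable_plus; [apply C_derivable_const|].
    apply C_derivable_mult; [apply C_derivable_const|].
    apply C_derivable_plus; (apply (C_derivable_comp cexp); [apply C_derivable_cexp|]);
      (apply C_derivable_plus; [|apply C_derivable_const]).
    + apply C_derivable_id.
    + apply C_derivable_mult; [apply C_derivable_const|apply C_derivable_id].
  - assert (E1 : cexp (z + (0, 2 * PI)%R + RtoC (- s))%C = cexp (z + RtoC (- s))%C).
    { rewrite <- (cexp_periodic (z + RtoC (- s))%C); f_equal; ring. }
    assert (E2 : cexp (RtoC (-1) * (z + (0, 2 * PI)%R) + RtoC s)%C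
                 = cexp (RtoC (-1) * z + RtoC s)%C).
    { rewrite <- (cexp_periodic (RtoC (-1) * (z + (0, 2 * PI)%R) + RtoC s)%C).
      f_equal; apply injective_projections; simpl; ring. }
    rewrite E1, E2; reflexivity.
Qed.

Lemma peak_ext_real (s t : R) : peak_ext s (s, t) = RtoC (peak t).
Proof.
  unfold peak_ext, cexp, peak, Cplus, Cmult, Re, Im, RtoC; simpl.
  replace (s + - s) with 0 by ring.
  replace (-1 * s - 0 * t + s) with 0 by ring.
  replace (-1 * t + 0 * s + 0) with (- t) by ring.
  rewrite Rplus_0_r, cos_neg, sin_neg, exp_0; f_equal; field.
Qed.

Lemma php_pow (f : C -> C) (n : nat) :
  periodic_half_plane f -> periodic_half_plane (fun z => f z ^ n)%C.
Proof.
  intros H; induction n as [|n IH]; simpl.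
  - apply php_const.
  - apply php_mult; assumption.
Qed.

Lemma vanishes_right_mult_l (k : C) (f : C -> C) :
  vanishes_right f -> vanishes_right (fun z => k * f z)%C.
Proof.
  intros H eps Heps; assert (Hk := Cmod_ge_0 k).
  destruct (H (eps / (Cmod k + 1))) as [M HM]; [apply Rdiv_lt_0_compat; lra|].
  exists M; intros z Hz; specialize (HM z Hz); rewrite Cmod_mult.
  apply Rle_lt_trans with (Cmod k * (eps / (Cmod k + 1))).
  - apply Rmult_le_compat_l; lra.
  - assert (0 < eps / (Cmod k + 1)) by (apply Rdiv_lt_0_compat; lra).
    replace eps with ((Cmod k + 1) * (eps / (Cmod k + 1))) at 2 by (field; lra).
    nra.
Qed.

Lemma vanishes_right_square (f : C -> C) :
  vanishes_right f -> vanishes_right (fun z => f z * f z)%C.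
Proof.
  intros H eps Heps.
  destruct (H (Rmin 1 eps)) as [M HM]; [apply Rmin_pos; lra|].
  exists M; intros z Hz; specialize (HM z Hz); rewrite Cmod_mult.
  apply Rmin_Rgt_l in HM; assert (P := Cmod_ge_0 (f z)); nra.
Qed.

Lemma boundary_zero (f : C -> C) (k : R) :
  periodic_half_plane f -> vanishes_right f ->
  (forall t, Im (f (0, t)) = k) ->
  forall t, 0 < t < 2 * PI -> f (0, t) = 0%C.
Proof.
  intros H V Hk; assert (P := PI_RGT_0).
  (* On the line Re(-i f) = Im f = k, so the mean of -i f at 0 is 2 pi k. *)
  assert (k0 : k = 0).
  { assert (M := mean_zero _ (php_mult _ _ (php_const (0, -1)) H)
                   (vanishes_right_mult_l (0, -1) _ V)).
    unfold mean in M; rewrite (RInt_Rext _ (fun _ => k)), RInt_Rconst in M.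
    - apply Rmult_integral in M; destruct M; lra.
    - lra.
    - intros t _; rewrite <- (Hk t); unfold Cmult, Re, Im; simpl; ring. }
  (* Once Im f = 0 on the line, Re(f^2) = (Re f)^2 there, a nonnegative function with zero
     integral. *)
  assert (S := mean_zero _ (php_mult _ _ H H) (vanishes_right_square _ V)).
  unfold mean in S.
  rewrite (RInt_Rext _ (fun t => Re (f (0, t)) * Re (f (0, t)))) in S.
  - intros t Ht.
    apply RInt_zero_nonneg with (x := t) in S.
    + apply injective_projections; simpl.
      * apply Rsqr_0_uniq; exact S.
      * transitivity k; [apply Hk|exact k0].
    + lra.
    + intros u; apply (continuous_mult (K := R_AbsRing));
        apply php_section_continuous; try assumption; lra.
    + intros u; apply Rle_0_sqr.
    + exact Ht.
  - lra.
  - intros t _; assert (E := Hk t); rewrite k0 in E.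
    unfold Cmult; unfold Re, Im in *; simpl; rewrite E; ring.
Qed.

(** The moments of f on Re z = s against powers of [peak] are means of f times powers of
    [peak_ext s]; moved to the boundary line, where f vanishes, they are 0. *)
Lemma php_zero_PI (f : C -> C) (k s : R) :
  periodic_half_plane f -> vanishes_right f ->
  (forall t, Im (f (0, t)) = k) -> 0 < s -> f (s, PI) = 0%C.
Proof.
  intros H V Hk Hs.
  assert (B := boundary_zero f k H V Hk); assert (P := PI_RGT_0).
  (* The factor c gives access to both parts of f(s, pi): c = 1 yields the real one, c = -i the
     imaginary one. *)
  assert (main : forall c : C, Re (c * f (s, PI))%C = 0).
  { intros c.
    assert (Hg := php_mult _ _ (php_const c) H).
    apply (peak_moments (fun t => Re (c * f (s, t))%C)).
    - intros t; apply (php_section_continuous _ s t Hg); lra.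
    - intros n.
      assert (Hn := php_mult _ _ Hg (php_pow _ n (peak_ext_php s))).
      assert (E := mean_boundary _ s Hn Hs).
      unfold mean in E.
      rewrite (RInt_Rext (fun t => Re (c * f (s, t))%C * peak t ^ n)
        (fun t => Re (c * f (s, t) * peak_ext s (s, t) ^ n)%C)).
      + rewrite E, (RInt_Rext _ (fun _ => 0)), RInt_Rconst; [apply Rmult_0_r|lra|].
        intros t Ht; rewrite (B t Ht); unfold Cmult, Re; simpl; ring.
      + lra.
      + intros t _; rewrite peak_ext_real, <- RtoC_pow.
        unfold Cmult, Re, RtoC; simpl; ring. }
  apply injective_projections; simpl.
  - assert (E := main 1%C); unfold Cmult, Re, RtoC in E; simpl in E; lra.
  - assert (E := main (0, -1)); unfold Cmult, Re in E; simpl in E; lra.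
Qed.

(** The hypotheses are invariant under vertical translations, which bring any point to the height pi
    where [peak] concentrates. *)
Theorem half_plane_uniqueness (f : C -> C) (k : R) :
  periodic_half_plane f -> vanishes_right f ->
  (forall t, Im (f (0, t)) = k) -> forall z, 0 < Re z -> f z = 0%C.
Proof.
  intros H V Hk [s t] Hs; simpl in Hs.
  set (tau := (0, t - PI) : C).
  assert (Etau : forall z, Re (z + tau)%C = Re z)
    by (intros z; unfold tau, Re, Cplus; simpl; ring).
  replace (s, t) with ((s, PI) + tau)%C
    by (unfold tau, Cplus; simpl; f_equal; ring).
  apply (php_zero_PI (fun z => f (z + tau)%C) k).
  - split.
    + intros z Hz; apply C_derivable_comp.
      * apply (php_derivable f H); rewrite Etau; exact Hz.
      * apply C_derivable_plus; [apply C_derivable_id|apply C_derivable_const].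
    + intros z Hz.
      replace (z + (0, 2 * PI)%R + tau)%C with (z + tau + (0, 2 * PI)%R)%C by ring.
      apply (php_periodic f H); rewrite Etau; exact Hz.
    + intros z.
      apply continuous_ext with (f := fun w => f (clamp (w + tau)%C)).
      { intros w; f_equal; unfold clamp, tau, Cplus, Re, Im; simpl.
        f_equal; rewrite !Rplus_0_r; reflexivity. }
      apply (continuous_comp (fun w : C => (w + tau)%C) (fun w => f (clamp w))).
      * apply continuous_Cplus; [apply continuous_id|apply continuous_const].
      * apply (php_continuous f H).
  - intros eps Heps; destruct (V eps Heps) as [M HM]; exists M; intros z Hz.
    apply HM; rewrite Etau; exact Hz.
  - intros u; rewrite <- (Hk (u + (t - PI))).
    do 2 f_equal; unfold tau, Cplus; simpl; f_equal; ring.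
  - exact Hs.
Qed.

(** * The potential of the ellipse *)

Lemma unit_circle_param (x y : R) :
  x ^ 2 + y ^ 2 = 1 -> exists t, x = cos t /\ y = sin t.
Proof.
  intros H.
  assert (Hx : -1 <= x <= 1) by (assert (Y := pow2_ge_0 y); nra).
  assert (Hs : sqrt (1 - Rsqr x) = Rabs y).
  { rewrite <- sqrt_Rsqr_abs; f_equal; unfold Rsqr; lra. }
  destruct (Rle_lt_dec 0 y) as [Hy|Hy].
  - exists (acos x); rewrite cos_acos, sin_acos, Hs, Rabs_pos_eq by assumption; auto.
  - exists (- acos x).
    rewrite cos_neg, sin_neg, cos_acos, sin_acos, Hs, Rabs_left by assumption.
    split; ring.
Qed.

Lemma cexp_surjective (z : C) : z <> 0%C -> exists w, cexp w = z.
Proof.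
  intros Hz; apply Cmod_gt_0 in Hz.
  destruct (unit_circle_param (Re z / Cmod z) (Im z / Cmod z)) as (t & H1 & H2).
  { replace (_ + _) with ((Re z ^ 2 + Im z ^ 2) / Cmod z ^ 2) by (field; lra).
    rewrite <- Cmod2_alt; field; lra. }
  exists (ln (Cmod z), t); unfold cexp; simpl.
  rewrite exp_ln, <- H1, <- H2 by exact Hz.
  apply injective_projections; simpl; unfold Re, Im; field; lra.
Qed.

Lemma C_sqrt_exists (z : C) : exists s, (s * s = z)%C.
Proof.
  destruct (Ceq_dec z 0) as [->|Hz]; [exists 0%C; ring|].
  destruct (cexp_surjective z Hz) as [w <-].
  exists (cexp (w / 2)%C); rewrite <- cexp_plus; f_equal; field.
Qed.

(** The image of the origin under [act p], hence the centre of the moved ellipse. *)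
Definition center (p : position) : C := (pos_r p - cis (theta p) * pos_s p)%C.

Lemma act_center (p : position) (z : C) : act p z = (center p + cis (theta p) * z)%C.
Proof. unfold act, center; ring. Qed.

Lemma cis_conj (t : R) : (Cconj (cis t) * cis t = 1)%C.
Proof.
  assert (H := sin2_cos2 t); unfold Rsqr in H.
  apply injective_projections; simpl; lra.
Qed.

Lemma Cmod_cis (t : R) : Cmod (cis t) = 1.
Proof.
  assert (H := sin2_cos2 t); unfold Rsqr in H.
  unfold Cmod, cis; simpl.
  replace (_ + _) with 1 by lra; apply sqrt_1.
Qed.

Lemma cis_neq_0 (t : R) : cis t <> 0%C.
Proof. apply Cmod_gt_0; rewrite Cmod_cis; lra. Qed.

Section Ellipse.

Variables (a b : R).
Hypotheses (hb : 0 < b) (hab : b < a).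

Definition ell_sum : R := (a + b) / 2.
Definition ell_diff : R := (a - b) / 2.

Definition joukowski (w : C) : C :=
  (RtoC ell_sum * cexp w + RtoC ell_diff * cexp (- w))%C.

Lemma joukowski_coord (s t : R) : joukowski (s, t) =
  ((ell_sum * exp s + ell_diff * exp (- s)) * cos t,
   (ell_sum * exp s - ell_diff * exp (- s)) * sin t).
Proof.
  unfold joukowski, cexp; simpl; rewrite cos_neg, sin_neg.
  apply injective_projections; simpl; ring.
Qed.

(** The vertical line of abscissa s is sent to the ellipse with the semi-axes A and B of the proof,
    and s > 0 gives A > a and B > b. *)
Lemma ellipse_exterior (w : C) : 0 < Re w -> ~ ellipse a b (joukowski w).
Proof.
  destruct w as [s t]; intros Hs; simpl in Hs; rewrite joukowski_coord.
  unfold ellipse; simpl Re; simpl Im; apply Rlt_not_le.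
  assert (E1 : 1 < exp s) by (rewrite <- exp_0; apply exp_increasing; lra).
  assert (E2 : exp (- s) < 1) by (rewrite <- exp_0; apply exp_increasing; lra).
  assert (E3 := exp_pos (- s)).
  set (A := ell_sum * exp s + ell_diff * exp (- s)).
  set (B := ell_sum * exp s - ell_diff * exp (- s)).
  assert (E4 : exp s * exp (- s) = 1) by (rewrite <- exp_plus, Rplus_opp_r; apply exp_0).
  assert (HA : a < A).
  { assert (K : A - a = (exp s - 1) * (ell_sum - ell_diff * exp (- s))).
    { unfold A; transitivity (ell_sum * exp s + ell_diff * exp (- s)
         - ell_sum - ell_diff * (exp s * exp (- s))); [rewrite E4|ring].
      unfold ell_sum, ell_diff; field. }
    assert (0 < (exp s - 1) * (ell_sum - ell_diff * exp (- s))).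
    { apply Rmult_lt_0_compat; [lra|]; unfold ell_sum, ell_diff; nra. }
    lra. }
  assert (HB : b < B) by (unfold B, ell_sum, ell_diff in *; nra).
  assert (HA2 : 1 < (A / a) ^ 2).
  { assert (1 < A / a) by (apply Rlt_div_r; lra); nra. }
  assert (HB2 : 1 < (B / b) ^ 2).
  { assert (1 < B / b) by (apply Rlt_div_r; lra); nra. }
  replace (_ + _) with ((A / a) ^ 2 * (cos t) ^ 2 + (B / b) ^ 2 * (sin t) ^ 2)
    by (field; lra).
  assert (H := sin2_cos2 t); unfold Rsqr in H.
  assert (P1 := pow2_ge_0 (cos t)); assert (P2 := pow2_ge_0 (sin t)).
  destruct (Rlt_le_dec 0 (cos t ^ 2)); nra.
Qed.

Lemma ellipse_rim (t : R) : ellipse a b (joukowski (0, t)).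
Proof.
  rewrite joukowski_coord; unfold ellipse; simpl Re; simpl Im.
  rewrite Ropp_0, exp_0; assert (H := sin2_cos2 t); unfold Rsqr in H.
  right; unfold ell_sum, ell_diff.
  transitivity (sin t * sin t + cos t * cos t); [field; lra|exact H].
Qed.

Variables (p : position) (v : velocity) (xi : C -> C).

Definition elliptic (w : C) : C := (center p + cis (theta p) * joukowski w)%C.

Lemma moved_elliptic (w : C) :
  moved p (ellipse a b) (elliptic w) <-> ellipse a b (joukowski w).
Proof.
  split.
  - intros (z & Hz & E); rewrite act_center in E; unfold elliptic in E.
    replace (joukowski w) with z; [exact Hz|].
    assert (E' : (cis (theta p) * joukowski w = cis (theta p) * z)%C).
    { replace (cis (theta p) * joukowski w)%C with
        (center p + cis (theta p) * joukowski w - center p)%C by ring.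
      rewrite E; ring. }
    rewrite <- (Cmult_1_l z), <- (Cmult_1_l (joukowski w)), <- (cis_conj (theta p)),
      <- !Cmult_assoc, E'; reflexivity.
  - intros H; exists (joukowski w); split; [exact H|symmetry; apply act_center].
Qed.

Lemma elliptic_exterior (w : C) : 0 < Re w -> ~ moved p (ellipse a b) (elliptic w).
Proof. rewrite moved_elliptic; apply ellipse_exterior. Qed.

Lemma elliptic_derivable (w : C) : C_derivable elliptic w.
Proof.
  unfold elliptic, joukowski.
  apply C_derivable_plus; [apply C_derivable_const|].
  apply C_derivable_mult; [apply C_derivable_const|].
  apply C_derivable_plus; (apply C_derivable_mult; [apply C_derivable_const|]).
  - apply C_derivable_cexp.
  - apply C_derivable_cexp_opp.
Qed.

Lemma elliptic_boundary (t : R) :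
  boundary (moved p (ellipse a b)) (elliptic (0, t)).
Proof.
  split; intros H.
  (* A neighbourhood inside the solid would pull back to a ball around (0, t), which contains the
     exterior parameter (d/2, t). *)
  - assert (K := C_derivable_continuous _ _ (elliptic_derivable (0, t)) _ H).
    destruct K as [d Hd]; assert (d0 := cond_pos d).
    apply (elliptic_exterior (d / 2, t)); [simpl; lra|].
    apply Hd; split; simpl.
    + change (Rabs (d / 2 - 0) < d); rewrite Rminus_0_r, Rabs_pos_eq; lra.
    + apply ball_center.
  - apply locally_singleton in H; apply H, moved_elliptic, ellipse_rim.
Qed.

Lemma elliptic_periodic (w : C) : elliptic (w + (0, 2 * PI)%R)%C = elliptic w.
Proof.
  unfold elliptic, joukowski; do 3 f_equal.
  - do 1 f_equal; apply cexp_periodic.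
  - f_equal; rewrite <- (cexp_periodic (- (w + (0, 2 * PI)%R))%C); f_equal; ring.
Qed.

(** Turns decay of xi at infinity into decay at the right of the half-plane. The modulus of
    [elliptic w] is at least ell_sum e^(Re w) - ell_diff - |center p|, and e^x >= 1 + x. *)
Lemma elliptic_large (M : R) :
  exists s, forall w, s < Re w -> M < Cmod (elliptic w).
Proof.
  exists (Rmax 0 ((M + Cmod (center p) + ell_diff) / ell_sum)).
  intros w Hw.
  assert (Hs : 0 < ell_sum) by (unfold ell_sum; lra).
  assert (Hd : 0 < ell_diff) by (unfold ell_diff; lra).
  apply Rmax_Rlt in Hw; destruct Hw as [Hw0 Hw].
  apply Rlt_div_l in Hw; [|exact Hs].
  assert (E1 := exp_ineq1_le (Re w)).
  assert (E2 : exp (- Re w) < 1) by (rewrite <- exp_0; apply exp_increasing; lra).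
  assert (T1 := Cmod_triangle (elliptic w) (- center p)%C).
  assert (T2 := Cmod_triangle (joukowski w) (- (RtoC ell_diff * cexp (- w)))%C).
  rewrite Cmod_opp in T1, T2.
  replace (elliptic w + - center p)%C with (cis (theta p) * joukowski w)%C in T1
    by (unfold elliptic; ring).
  replace (joukowski w + - (RtoC ell_diff * cexp (- w)))%C
    with (RtoC ell_sum * cexp w)%C in T2 by (unfold joukowski; ring).
  rewrite Cmod_mult, Cmod_cis in T1.
  rewrite !Cmod_mult, !Cmod_cexp, !Cmod_R, !Rabs_pos_eq in T2 by lra.
  change (Re (- w)%C) with (- Re w) in T2.
  nra.
Qed.

Lemma vanishes_right_cexp_opp : vanishes_right (fun w => cexp (- w)%C).
Proof.
  intros eps Heps; exists (- ln eps); intros z Hz.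
  rewrite Cmod_cexp; change (Re (- z)%C) with (- Re z).
  rewrite <- (exp_ln eps) at 1 by exact Heps; apply exp_increasing; lra.
Qed.

Lemma vanishes_right_plus (f g : C -> C) :
  vanishes_right f -> vanishes_right g -> vanishes_right (fun z => f z + g z)%C.
Proof.
  intros Hf Hg eps Heps.
  destruct (Hf (eps / 2)) as [M1 H1]; [lra|]; destruct (Hg (eps / 2)) as [M2 H2]; [lra|].
  exists (Rmax M1 M2); intros z Hz.
  assert (X1 := Rmax_l M1 M2); assert (X2 := Rmax_r M1 M2).
  eapply Rle_lt_trans; [apply Cmod_triangle|].
  specialize (H1 z ltac:(lra)); specialize (H2 z ltac:(lra)); lra.
Qed.

(* The velocity at the centre, in the frame of the axes of the ellipse. *)
Definition axial_velocity : C := (Cconj (cis (theta p)) * field v (center p))%C.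

(** With U the axial velocity, the product with e^(-it) has imaginary part Im(conj U (a cos t + i b
    sin t)), the stream function of the translation on the rim. *)
Definition dipole : C := (- (b * Re axial_velocity), - (a * Im axial_velocity)).

(** Equal to -i omega (a^2 - b^2)/4; times e^(-2it), its imaginary part is the nonconstant part of
    -omega/2 (a^2 cos^2 t + b^2 sin^2 t). *)
Definition quadrupole : C := (0, - (omega v * ell_sum * ell_diff)).

Definition ell_potential (w : C) : C :=
  (dipole * cexp (- w) + quadrupole * (cexp (- w) * cexp (- w)))%C.

(** When |x - s|^2 is expanded about the centre, the cross term merges with w into the velocity of
    the centre, matched by [dipole]; the pure square is matched by [quadrupole] up to a constant. *)
Lemma ell_potential_slip (c0 t : R) :
  Im (Cconj (vel_w v) * elliptic (0, t))%C
    - omega v / 2 * Cmod (elliptic (0, t) - vel_s v)%C ^ 2 + c0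
    - Im (ell_potential (0, t)) =
  c0 + Im (Cconj (vel_w v) * center p)%C
    - omega v / 2 * Cmod (center p - vel_s v)%C ^ 2
    - omega v / 4 * (a ^ 2 + b ^ 2).
Proof.
  unfold elliptic; rewrite joukowski_coord, Ropp_0, exp_0, !Cmod2_alt.
  unfold ell_potential, dipole, quadrupole, axial_velocity, field, cexp, cis,
    ell_sum, ell_diff; simpl.
  rewrite Ropp_0, exp_0, cos_neg, sin_neg.
  assert (H1 := sin2_cos2 (theta p)); assert (H2 := sin2_cos2 t); unfold Rsqr in H1, H2.
  destruct (center p) as [cx cy], (vel_s v) as [sx sy], (vel_w v) as [wx wy].
  revert H1 H2; generalize (cos (theta p)) (sin (theta p)) (cos t) (sin t) (omega v).
  intros ct st C S om H1 H2; simpl.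
  apply Rminus_diag_uniq.
  (* The two sides differ by multiples of the Pythagorean relations for theta and t. *)
  transitivity (- om / 2 * (a ^ 2 * C ^ 2 + b ^ 2 * S ^ 2) * (st * st + ct * ct - 1)
     - om / 4 * (a ^ 2 + b ^ 2) * (S * S + C * C - 1)).
  - field.
  - rewrite H1, H2; field.
Qed.

(** Both sides extend continuously to the line Re w = 0, where the slip condition makes their
    imaginary parts differ by a constant, so [half_plane_uniqueness] applies to the difference. *)
Lemma potential_elliptic :
  complex_potential (ellipse a b) p v xi ->
  forall w, 0 < Re w -> xi (elliptic w) = ell_potential w.
Proof.
  intros (Hhol & Hinf & g & Hg & Hcont & c0 & Hslip).
  set (E := fun w => (RtoC (-1) * ell_potential w)%C).
  assert (HE : forall w, C_derivable E w).
  { intros w; unfold E, ell_potential.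
    assert (Hq := C_derivable_cexp_opp w).
    apply C_derivable_mult; [apply C_derivable_const|].
    apply C_derivable_plus; (apply C_derivable_mult; [apply C_derivable_const|]).
    - exact Hq.
    - apply C_derivable_mult; exact Hq. }
  assert (PE : periodic_half_plane E).
  { apply php_entire; [exact HE|]; intros w; unfold E, ell_potential.
    replace (cexp (- (w + (0, 2 * PI)%R))%C) with (cexp (- w)%C); [reflexivity|].
    rewrite <- (cexp_periodic (- (w + (0, 2 * PI)%R))%C); f_equal; ring. }
  assert (VE : vanishes_right E).
  { apply vanishes_right_mult_l, vanishes_right_plus; apply vanishes_right_mult_l.
    - apply vanishes_right_cexp_opp.
    - apply (vanishes_right_square (fun w => cexp (- w)%C)), vanishes_right_cexp_opp. }
  assert (Pg : periodic_half_plane (fun w => g (elliptic w))).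
  { split; intros w.
    - intros Hw.
      assert (D := ex_derive_C_derivable _ _ (Hhol _ (elliptic_exterior w Hw))).
      destruct (C_derivable_comp _ _ _ D (elliptic_derivable w)) as [m Hm].
      exists m; rewrite is_C_derive_epsilon in Hm |- *; intros eps Heps.
      destruct (Hm eps Heps) as (d & Hd & K).
      (* A radius at most Re w keeps w + h in the open half-plane, where g and xi agree along
         [elliptic]. *)
      exists (Rmin d (Re w)); split; [apply Rmin_pos; assumption|]; intros h Hh.
      apply Rmin_Rgt_l in Hh; destruct Hh as [Hh1 Hh2].
      rewrite !Hg; [apply K; lra|apply elliptic_exterior, Hw|].
      apply elliptic_exterior; change (0 < Re w + Re h).
      assert (A := re_le_Cmod h); apply Rabs_le_between in A; lra.
    - intros Hw; rewrite elliptic_periodic; reflexivity.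
    - assert (Hc : continuous (fun w => elliptic (clamp w)) w).
      { apply (continuous_comp clamp elliptic); [apply continuous_clamp|].
        apply C_derivable_continuous, elliptic_derivable. }
      (* Every clamped parameter lands in the exterior or on the boundary, so continuity of g
         relative to that set suffices. *)
      assert (HD : forall w, ~ moved p (ellipse a b) (elliptic (clamp w)) \/
                 boundary (moved p (ellipse a b)) (elliptic (clamp w))).
      { intros [s t]; unfold clamp; simpl; unfold Rmax; destruct Rle_dec as [Hs|Hs].
        - destruct (Req_dec s 0) as [->|N]; [right; apply elliptic_boundary|].
          left; apply elliptic_exterior; simpl; lra.
        - right; apply elliptic_boundary. }
      intros P HP; specialize (Hcont _ (HD w) P HP).
      assert (K := Hc _ Hcont); unfold filtermap, within in *.
      refine (filter_imp _ _ _ K); intros u Hu; apply Hu, HD. }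
  assert (Vg : vanishes_right (fun w => g (elliptic w))).
  { intros eps Heps; destruct (Hinf eps Heps) as [M HM].
    destruct (elliptic_large M) as [s Hs]; exists (Rmax 0 s); intros w Hw.
    apply Rmax_Rlt in Hw; destruct Hw as [Hw0 Hw].
    rewrite Hg by (apply elliptic_exterior; exact Hw0); apply HM, Hs, Hw. }
  intros w Hw.
  assert (U := half_plane_uniqueness _ (c0 + Im (Cconj (vel_w v) * center p)%C
    - omega v / 2 * Cmod (center p - vel_s v)%C ^ 2
    - omega v / 4 * (a ^ 2 + b ^ 2)) (php_plus _ _ Pg PE) (vanishes_right_plus _ _ Vg VE)).
  rewrite <- Hg by (apply elliptic_exterior; exact Hw).
  specialize (fun H => U H w Hw).
  replace (g (elliptic w)) with (g (elliptic w) + E w + ell_potential w)%C.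
  - rewrite U; [ring|]; intros t.
    rewrite <- (ell_potential_slip c0 t), <- (Hslip _ (elliptic_boundary t)).
    unfold E, Im; simpl; ring.
  - unfold E; apply injective_projections; simpl; ring.
Qed.

(** Equal to e^(2 i theta) (a^2 - b^2)/4: the foci of the moved ellipse are the centre plus or minus
    twice a square root of it. *)
Definition focal : C := (RtoC (ell_sum * ell_diff) * (cis (theta p) * cis (theta p)))%C.

Definition laurent1 : C := (RtoC ell_sum * cis (theta p) * dipole)%C.

Definition laurent2 : C :=
  (RtoC (ell_sum * ell_sum) * (cis (theta p) * cis (theta p)) * quadrupole)%C.

(** The substitution eta = ell_sum e^(i theta) e^w turns Re w > 0 into |eta| > ell_sum, and
    surjectivity of the exponential supplies w. *)
Lemma potential_laurent (eta : C) :
  complex_potential (ellipse a b) p v xi -> ell_sum < Cmod eta ->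
  xi (center p + eta + focal / eta)%C = (laurent1 / eta + laurent2 / (eta * eta))%C.
Proof.
  intros Hxi Heta.
  assert (Hs : 0 < ell_sum) by (unfold ell_sum; lra).
  assert (Ns : RtoC ell_sum <> 0%C)
    by (apply Cmod_gt_0; rewrite Cmod_R, Rabs_pos_eq; lra).
  assert (Ne : eta <> 0%C) by (apply Cmod_gt_0; lra).
  assert (Nc := cis_neq_0 (theta p)).
  assert (Nz : (eta / (RtoC ell_sum * cis (theta p)) <> 0)%C).
  { intros E; apply Ne.
    replace eta with (eta / (RtoC ell_sum * cis (theta p)) *
       (RtoC ell_sum * cis (theta p)))%C by (field; auto).
    rewrite E; ring. }
  destruct (cexp_surjective _ Nz) as [w Hw].
  assert (Hre : 0 < Re w).
  { apply exp_lt_inv; rewrite exp_0, <- Cmod_cexp, Hw, Cmod_div, Cmod_mult, Cmod_R,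
      Cmod_cis, Rabs_pos_eq, Rmult_1_r.
    - apply Rlt_div_r; lra.
    - lra.
    - apply Cmult_neq_0; assumption. }
  assert (H := potential_elliptic Hxi w Hre).
  unfold elliptic, joukowski, ell_potential in H; rewrite cexp_opp, Hw in H.
  unfold focal, laurent1, laurent2; rewrite !RtoC_mult.
  replace (center p + eta + _)%C with (center p + cis (theta p) *
    (RtoC ell_sum * (eta / (RtoC ell_sum * cis (theta p))) +
     RtoC ell_diff * / (eta / (RtoC ell_sum * cis (theta p)))))%C by (field; auto).
  rewrite H; field; auto.
Qed.

End Ellipse.

(** * Reconstruction from the Laurent expansion *)

Lemma Cmult_integral (x y : C) : (x * y = 0 -> x = 0 \/ y = 0)%C.
Proof.
  intros H; destruct (Ceq_dec x 0) as [Hx|Hx]; [left; exact Hx|].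
  destruct (Ceq_dec y 0) as [Hy|Hy]; [right; exact Hy|].
  destruct (Cmult_neq_0 x y Hx Hy H).
Qed.

(** * Polynomials vanishing near the origin *)

Fixpoint horner (l : list C) (x : C) : C :=
  match l with [] => 0%C | c :: l => (c + x * horner l x)%C end.

Lemma horner_bounded (l : list C) :
  exists M, 0 <= M /\ forall x, Cmod x <= 1 -> Cmod (horner l x) <= M.
Proof.
  induction l as [|c l (M & HM & IH)]; simpl.
  - exists 0; split; [lra|]; intros; rewrite Cmod_0; lra.
  - exists (Cmod c + M); assert (Hc := Cmod_ge_0 c); split; [lra|]; intros x Hx.
    eapply Rle_trans; [apply Cmod_triangle|]; rewrite Cmod_mult.
    specialize (IH x Hx); assert (Hl := Cmod_ge_0 (horner l x)).
    assert (Hx0 := Cmod_ge_0 x); nra.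
Qed.

(** Letting x tend to 0 kills the constant coefficient; the factor x is then divided out and
    induction applies. *)
Lemma horner_zero (l : list C) (d : R) :
  0 < d -> (forall x, 0 < Cmod x < d -> horner l x = 0%C) ->
  List.Forall (fun c : C => c = 0%C) l.
Proof.
  intros Hd; induction l as [|c l IH]; intros H; [constructor|].
  assert (Hc : c = 0%C).
  { apply Cmod_eq_0, Rle_antisym; [|apply Cmod_ge_0].
    destruct (horner_bounded l) as (M & HM & HB).
    apply le_epsilon; intros eps Heps; rewrite Rplus_0_l.
    (* The minimum keeps e within the radius d and within the unit disc of [horner_bounded], and
       makes e * M at most eps. *)
    set (e := Rmin (d / 2) (Rmin 1 (eps / (M + 1)))).
    assert (Hq : 0 < eps / (M + 1)) by (apply Rdiv_lt_0_compat; lra).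
    assert (He : 0 < e) by (repeat apply Rmin_pos; lra).
    assert (He1 : e <= d / 2) by apply Rmin_l.
    assert (He2 : e <= 1) by (eapply Rle_trans; [apply Rmin_r|apply Rmin_l]).
    assert (He3 : e <= eps / (M + 1)) by (eapply Rle_trans; [apply Rmin_r|apply Rmin_r]).
    assert (Hm : Cmod (RtoC e) = e) by (rewrite Cmod_R; apply Rabs_pos_eq; lra).
    assert (K := H (RtoC e) ltac:(rewrite Hm; lra)); simpl in K.
    assert (E : c = (- (RtoC e * horner l (RtoC e)))%C).
    { rewrite <- (Cplus_0_r (- _)), <- K; ring. }
    rewrite E, Cmod_opp, Cmod_mult, Hm.
    assert (B := HB (RtoC e) ltac:(lra)).
    assert (B0 := Cmod_ge_0 (horner l (RtoC e))).
    replace eps with (eps / (M + 1) * (M + 1)) by (field; lra).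
    apply Rmult_le_compat; lra. }
  constructor; [exact Hc|apply IH].
  intros x Hx; specialize (H x Hx); simpl in H; rewrite Hc, Cplus_0_l in H.
  apply Cmult_integral in H; destruct H as [H|H]; [|exact H].
  rewrite H, Cmod_0 in Hx; lra.
Qed.

(* Eliminating [eta] between z = c + eta + k/eta and xi = A/eta + B/eta^2: the
   two roots eta and k/eta give two values of xi, whose sum and product are
   polynomials in y = z - c. *)
Lemma laurent_quadratic (k A B eta y x : C) :
  k <> 0%C -> eta <> 0%C -> (y = eta + k / eta)%C ->
  (x = A / eta + B / (eta * eta))%C ->
  (x * x - (A / k * y + B / (k * k) * (y * y) - 2 * B / k) * x
   + (A * A / k + A * B / (k * k) * y + B * B / (k * k)) = 0)%C.
Proof. intros Hk He -> ->; field; auto. Qed.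

(** The roots (y + s)/2 and (y - s)/2 of eta^2 - y eta + k have sum y, so they cannot both have
    modulus at most r. *)
Lemma quadratic_root (y k : C) (r : R) :
  0 <= r -> 2 * r < Cmod y ->
  (exists s, (s * s = y * y - 4 * k)%C) ->
  exists eta, r < Cmod eta /\ (y = eta + k / eta)%C.
Proof.
  intros Hr Hy [s Hs].
  assert (main : forall s, (s * s = y * y - 4 * k)%C -> r < Cmod ((y + s) / 2)%C ->
     exists eta, r < Cmod eta /\ (y = eta + k / eta)%C).
  { clear s Hs; intros s Hs Hc; exists ((y + s) / 2)%C; split; [exact Hc|].
    assert (Hn : ((y + s) / 2 <> 0)%C) by (apply Cmod_gt_0; lra).
    assert (Hn' : (y + s <> 0)%C).
    { intros E; apply Hn; rewrite E; unfold Cdiv; ring. }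
    replace k with ((y * y - s * s) / 4)%C by (rewrite Hs; field).
    field; exact Hn'. }
  destruct (Rlt_le_dec r (Cmod ((y + s) / 2)%C)) as [H1|H1]; [exact (main s Hs H1)|].
  apply (main (- s)%C); [rewrite <- Hs; ring|].
  assert (T := Cmod_triangle ((y + s) / 2)%C ((y + - s) / 2)%C).
  replace ((y + s) / 2 + (y + - s) / 2)%C with y in T by field.
  lra.
Qed.

(** In x = 1/eta the relation is a Laurent polynomial that vanishes near 0, so all its coefficients
    vanish. This is the form in which the irrationality of xi is used: a relation of degree one in
    xi must be trivial. *)
Lemma laurent_linear_relation (k A B t0 t1 t2 n0 n1 : C) (r : R) :
  k <> 0%C -> ~ (A = 0%C /\ B = 0%C) ->
  (forall eta, r < Cmod eta -> forall y, (y = eta + k / eta)%C ->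
    ((t0 + t1 * y + t2 * (y * y)) * (A / eta + B / (eta * eta)) = n0 + n1 * y)%C) ->
  (t0 = 0 /\ t1 = 0 /\ t2 = 0 /\ n0 = 0 /\ n1 = 0)%C.
Proof.
  intros Hk HAB H.
  (* The coefficients of x^-1, ..., x^4 for x = 1/eta and y = 1/x + k x; multiplication by x makes
     the relation polynomial. *)
  set (l := [A * t2 - n1; A * t1 + B * t2 - n0;
             A * (t0 + 2 * k * t2) + B * t1 - n1 * k;
             A * t1 * k + B * (t0 + 2 * k * t2);
             A * t2 * (k * k) + B * t1 * k; B * t2 * (k * k)]%C).
  assert (F : List.Forall (fun c : C => c = 0%C) l).
  { assert (Hr : 0 < Rmax r 0 + 1) by (assert (M := Rmax_r r 0); lra).
    apply (horner_zero l (/ (Rmax r 0 + 1))); [apply Rinv_0_lt_compat, Hr|].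
    intros x [Hx0 Hx].
    assert (Nx : x <> 0%C) by (apply Cmod_gt_0; exact Hx0).
    assert (Hinv : r < Cmod (/ x)%C).
    { rewrite Cmod_inv by exact Nx.
      apply Rlt_le_trans with (Rmax r 0 + 1); [assert (M := Rmax_l r 0); lra|].
      rewrite <- (Rinv_inv (Rmax r 0 + 1)); apply Rinv_le_contravar; lra. }
    assert (K := H _ Hinv _ eq_refl).
    assert (Z : (x * ((t0 + t1 * (/ x + k / / x)
        + t2 * ((/ x + k / / x) * (/ x + k / / x))) *
        (A / / x + B / (/ x * / x)) - (n0 + n1 * (/ x + k / / x))) = 0)%C)
      by (rewrite K; ring).
    rewrite <- Z; simpl; field; exact Nx. }
  unfold l in F; clear l H.
  inversion_clear F as [|? ? E0 F1]; inversion_clear F1 as [|? ? E1 F2];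
    inversion_clear F2 as [|? ? E2 F3]; inversion_clear F3 as [|? ? E3 F4];
    inversion_clear F4 as [|? ? E4 F5]; inversion_clear F5 as [|? ? E5 F6]; clear F6.
  (* If B <> 0, the three top coefficients give t2, t1, t0 in turn. If B = 0, the degree drops by
     one and n1, read off from the lowest coefficient, is needed before t0. *)
  assert (Z : (t0 = 0 /\ t1 = 0 /\ t2 = 0)%C).
  { destruct (Ceq_dec B 0) as [->|HB].
    - assert (HA : A <> 0%C) by (intros E; apply HAB; split; [exact E|reflexivity]).
      assert (cancel : forall u, (A * u = 0)%C -> u = 0%C)
        by (intros u Hu; apply Cmult_integral in Hu; destruct Hu; [contradiction|assumption]).
      assert (cancelk : forall u, (u * k = 0)%C -> u = 0%C)
        by (intros u Hu; apply Cmult_integral in Hu; destruct Hu; [assumption|contradiction]).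
      assert (T2 : t2 = 0%C).
      { apply cancel, cancelk, cancelk; rewrite <- E4; ring. }
      assert (T1 : t1 = 0%C).
      { apply cancel, cancelk; rewrite <- E3; ring. }
      assert (N1 : n1 = 0%C).
      { rewrite T2 in E0. replace n1 with (- (A * 0 - n1))%C by ring. rewrite E0; ring. }
      split; [|auto]; apply cancel; rewrite <- E2, T1, T2, N1; ring.
    - assert (cancel : forall u, (B * u = 0)%C -> u = 0%C)
        by (intros u Hu; apply Cmult_integral in Hu; destruct Hu; [contradiction|assumption]).
      assert (cancelk : forall u, (u * k = 0)%C -> u = 0%C)
        by (intros u Hu; apply Cmult_integral in Hu; destruct Hu; [assumption|contradiction]).
      assert (T2 : t2 = 0%C).
      { apply cancel, cancelk, cancelk; rewrite <- E5; ring. }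
      assert (T1 : t1 = 0%C).
      { apply cancel, cancelk; rewrite <- E4, T2; ring. }
      split; [|auto]; apply cancel; rewrite <- E3, T1, T2; ring. }
  destruct Z as (-> & -> & ->); repeat split.
  - replace n0 with (- (A * 0 + B * 0 - n0))%C by ring; rewrite E1; ring.
  - replace n1 with (- (A * 0 - n1))%C by ring; rewrite E0; ring.
Qed.

(* Here A = a k and B = b k^2, which turns the coefficients of the two
   quadratic equations into polynomials. *)
Lemma laurent_parameters (k1 k2 a1 a2 b d : C) :
  (k1 <> 0 -> k2 <> 0 -> ~ (a1 = 0 /\ b = 0) ->
   a1 - a2 - 2 * b * d = 0 ->
   - (2 * b * k1) - a2 * d - b * (d * d) + 2 * b * k2 = 0 ->
   k1 * a1 * b - k2 * a2 * b = 0 ->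
   a1 * a1 * k1 + b * b * k1 * k1 - a2 * a2 * k2 - a2 * k2 * b * d - b * b * k2 * k2 = 0 ->
   d = 0 /\ k1 = k2)%C.
Proof.
  intros Hk1 Hk2 Hab H1 H0 Hn1 Hn0.
  assert (sub : forall u v : C, (u - v = 0)%C -> u = v).
  { intros u v E; replace u with (u - v + v)%C by ring; rewrite E; ring. }
  destruct (Ceq_dec b 0) as [->|Hb].
  - assert (Ea : a2 = a1) by (symmetry; apply sub; rewrite <- H1; ring).
    subst a2.
    assert (Ha : a1 <> 0%C) by (intros E; apply Hab; auto).
    assert (cancel : forall u, (a1 * u = 0)%C -> u = 0%C)
      by (intros u Hu; apply Cmult_integral in Hu; destruct Hu; [contradiction|assumption]).
    split.
    + apply cancel. replace (a1 * d)%C with (- (- (a1 * d)))%C by ring.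
      replace (- (a1 * d))%C with (RtoC 0); [ring|]; rewrite <- H0; ring.
    + apply sub, cancel, cancel; rewrite <- Hn0; ring.
  - assert (cancel : forall u, (b * u = 0)%C -> u = 0%C)
      by (intros u Hu; apply Cmult_integral in Hu; destruct Hu; [contradiction|assumption]).
    assert (cancel2 : forall u, (k2 * u = 0)%C -> u = 0%C)
      by (intros u Hu; apply Cmult_integral in Hu; destruct Hu; [contradiction|assumption]).
    assert (square : forall u, (u * u = 0)%C -> u = 0%C)
      by (intros u Hu; apply Cmult_integral in Hu; destruct Hu; assumption).
    assert (Ea : (a1 = a2 + 2 * b * d)%C) by (apply sub; rewrite <- H1; ring).
    subst a1; clear H1.
    set (D := (k2 - k1)%C).
    assert (Hi : (2 * b * d * k1 - a2 * D = 0)%C)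
      by (apply cancel; rewrite <- Hn1; unfold D; ring).
    assert (Hii : (d * (a2 + b * d) - 2 * b * D = 0)%C).
    { replace (_ - _)%C with (- (- (2 * b * k1) - a2 * d - b * (d * d) + 2 * b * k2))%C
        by (unfold D; ring).
      rewrite H0; ring. }
    assert (Hiii : (a2 * k2 * d - b * D * (k1 + k2) = 0)%C).
    { apply cancel.
      replace (b * (a2 * k2 * d - b * D * (k1 + k2)))%C with
        (((a2 + 2 * b * d) * (a2 + 2 * b * d) * k1 + b * b * k1 * k1
          - a2 * a2 * k2 - a2 * k2 * b * d - b * b * k2 * k2)
         - (a2 + 2 * b * d) * (2 * b * d * k1 - a2 * D))%C by (unfold D; ring).
      rewrite Hn0, Hi; ring. }
    assert (Hiv : (d * d * k2 - D * D = 0)%C).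
    { apply cancel.
      replace (b * (d * d * k2 - D * D))%C with
        (k2 * (d * (a2 + b * d) - 2 * b * D) - (a2 * k2 * d - b * D * (k1 + k2)))%C
        by (unfold D; ring).
      rewrite Hii, Hiii; ring. }
    assert (D0 : D = 0%C).
    { apply square.
      (* In this combination of [Hi], [Hiii] and [Hiv] both a2 and d cancel, leaving b D^3. *)
      assert (E : (D * (D * D) = 0)%C).
      { apply cancel.
        replace (b * (D * (D * D)))%C with
          (- (k2 * d * (2 * b * d * k1 - a2 * D)) - D * (a2 * k2 * d - b * D * (k1 + k2))
           + 2 * b * k1 * (d * d * k2 - D * D))%C by (unfold D; ring).
        rewrite Hi, Hiii, Hiv; ring. }
      apply Cmult_integral in E; destruct E as [-> | E]; [ring|exact E]. }
    split.
    + apply square, cancel2; rewrite D0 in Hiv; rewrite <- Hiv; ring.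
    + symmetry; apply sub; exact D0.
Qed.

Lemma C_minus_eq (x y : C) : (x - y = 0)%C -> x = y.
Proof. intros E; replace x with (x - y + y)%C by ring; rewrite E; ring. Qed.

Lemma C_mult_cancel (z x y : C) : z <> 0%C -> (z * x = z * y)%C -> x = y.
Proof.
  intros Hz H; apply C_minus_eq.
  assert (E : (z * (x - y) = 0)%C)
    by (replace (z * (x - y))%C with (z * x - z * y)%C by ring; rewrite H; ring).
  apply Cmult_integral in E; destruct E; [contradiction|assumption].
Qed.

(** At a common point z the value of both potentials satisfies two monic quadratic equations over
    C[z]. Their difference is of degree one in that value, so [laurent_linear_relation] kills its
    coefficients and [laurent_parameters] solves the resulting system. *)
Lemma laurent_rigidity (c1 c2 k1 k2 A1 A2 B1 B2 : C) (xi1 xi2 : C -> C) (r rho : R) :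
  0 <= r -> k1 <> 0%C -> k2 <> 0%C -> ~ (A1 = 0%C /\ B1 = 0%C) ->
  (forall eta, r < Cmod eta ->
     xi1 (c1 + eta + k1 / eta)%C = (A1 / eta + B1 / (eta * eta))%C) ->
  (forall eta, r < Cmod eta ->
     xi2 (c2 + eta + k2 / eta)%C = (A2 / eta + B2 / (eta * eta))%C) ->
  (forall z, rho < Cmod z -> xi1 z = xi2 z) ->
  c1 = c2 /\ k1 = k2 /\ A1 = A2 /\ B1 = B2.
Proof.
  intros Hr Hk1 Hk2 HAB H1 H2 Heq.
  set (d := (c1 - c2)%C).
  set (a1 := (A1 / k1)%C); set (a2 := (A2 / k2)%C).
  set (b1 := (B1 / (k1 * k1))%C); set (b2 := (B2 / (k2 * k2))%C).
  assert (EA1 : A1 = (a1 * k1)%C) by (unfold a1; field; exact Hk1).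
  assert (EA2 : A2 = (a2 * k2)%C) by (unfold a2; field; exact Hk2).
  assert (EB1 : B1 = (b1 * (k1 * k1))%C) by (unfold b1; field; exact Hk1).
  assert (EB2 : B2 = (b2 * (k2 * k2))%C) by (unfold b2; field; exact Hk2).
  clearbody a1 a2 b1 b2.
  destruct (laurent_linear_relation k1 A1 B1
    (- (2 * b1 * k1) - a2 * d - b2 * (d * d) + 2 * b2 * k2)%C
    (a1 - a2 - 2 * b2 * d)%C (b1 - b2)%C
    (a1 * a1 * k1 + b1 * b1 * k1 * k1 - a2 * a2 * k2 - a2 * k2 * b2 * d - b2 * b2 * k2 * k2)%C
    (k1 * a1 * b1 - k2 * a2 * b2)%C
    (* This threshold makes |k1/eta| <= |k1|, places c1 + y beyond rho and gives |y + d| > 2 r, as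
       [quadratic_root] requires. *)
    (Rmax r (Rmax 1 (Rabs rho + Cmod c1 + Cmod k1 + 2 * r + Cmod d))) Hk1 HAB)
    as (E0 & E1 & E2 & N0 & N1).
  { intros eta Heta y Hy.
    apply Rmax_Rlt in Heta; destruct Heta as [He1 Heta].
    apply Rmax_Rlt in Heta; destruct Heta as [He2 He3].
    assert (Ne : eta <> 0%C) by (apply Cmod_gt_0; lra).
    assert (Hke : Cmod (k1 / eta)%C <= Cmod k1).
    { rewrite Cmod_div by exact Ne; apply Rle_div_l; [lra|].
      assert (K := Cmod_ge_0 k1); nra. }
    assert (Hrho := Rle_abs rho); assert (Hrho0 := Rabs_pos rho).
    assert (Hylow : Cmod eta - Cmod k1 <= Cmod y).
    { assert (T := Cmod_triangle y (- (k1 / eta))%C); rewrite Cmod_opp in T.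
      replace (y + - (k1 / eta))%C with eta in T by (rewrite Hy; ring); lra. }
    assert (Gc := Cmod_ge_0 c1); assert (Gd := Cmod_ge_0 d).
    assert (Hz : rho < Cmod (c1 + y)%C).
    { assert (T := Cmod_triangle (c1 + y)%C (- c1)%C); rewrite Cmod_opp in T.
      replace (c1 + y + - c1)%C with y in T by ring; lra. }
    assert (Hyd : 2 * r < Cmod (y + d)%C).
    { assert (T := Cmod_triangle (y + d)%C (- d)%C); rewrite Cmod_opp in T.
      replace (y + d + - d)%C with y in T by ring; lra. }
    destruct (quadratic_root (y + d)%C k2 r Hr Hyd (C_sqrt_exists _))
      as (eta2 & Heta2 & Ey2).
    assert (Ne2 : eta2 <> 0%C) by (apply Cmod_gt_0; lra).
    assert (X1 := H1 eta He1); assert (X2 := H2 eta2 Heta2).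
    replace (c1 + eta + k1 / eta)%C with (c1 + y)%C in X1 by (rewrite Hy; ring).
    replace (c2 + eta2 + k2 / eta2)%C with (c1 + y)%C in X2.
    2: { replace (c2 + eta2 + k2 / eta2)%C with (c2 + (eta2 + k2 / eta2))%C by ring.
         rewrite <- Ey2; unfold d; ring. }
    rewrite <- (Heq _ Hz) in X2.
    assert (Q1 := laurent_quadratic k1 A1 B1 eta y _ Hk1 Ne Hy X1).
    assert (Q2 := laurent_quadratic k2 A2 B2 eta2 _ _ Hk2 Ne2 Ey2 X2).
    rewrite <- X1; set (x := xi1 (c1 + y)%C) in *.
    rewrite EA1, EB1 in Q1; rewrite EA2, EB2 in Q2.
    apply C_minus_eq.
    match type of Q1 with ?q1 = _ => match type of Q2 with ?q2 = _ =>
      transitivity (q2 - q1)%C; [field; auto|rewrite Q1, Q2; ring] end end. }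
  assert (Eb : b1 = b2) by (apply C_minus_eq; exact E2).
  subst b2.
  destruct (laurent_parameters k1 k2 a1 a2 b1 d Hk1 Hk2) as [Ed Ek]; auto.
  { intros [Ea Eb']; apply HAB; rewrite EA1, EB1, Ea, Eb'; split; ring. }
  assert (Ea : a1 = a2).
  { apply C_minus_eq; rewrite <- E1, Ed; ring. }
  split; [apply C_minus_eq; exact Ed|split; [exact Ek|]].
  rewrite EA1, EA2, EB1, EB2, Ea, Ek; split; reflexivity.
Qed.

(** * From the Laurent coefficients to position and velocity *)

Section Reconstruction.

Variables (a b : R).
Hypotheses (hb : 0 < b) (hab : b < a).

Lemma ell_sum_pos : 0 < ell_sum a b.
Proof. unfold ell_sum; lra. Qed.

Lemma ell_diff_pos : 0 < ell_diff a b.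
Proof. unfold ell_diff; lra. Qed.

Lemma focal_neq_0 (p : position) : focal a b p <> 0%C.
Proof.
  assert (H1 := ell_sum_pos); assert (H2 := ell_diff_pos).
  apply Cmod_gt_0; unfold focal; rewrite !Cmod_mult, !Cmod_cis, Cmod_R, Rabs_pos_eq; nra.
Qed.

Lemma field_center (p : position) (v : velocity) (z : C) :
  field v z = (Ci * omega v * (z - center p) + field v (center p))%C.
Proof. unfold field; ring. Qed.

Lemma axial_velocity_field (p : position) (v : velocity) :
  field v (center p) = (cis (theta p) * axial_velocity p v)%C.
Proof.
  unfold axial_velocity; rewrite Cmult_assoc, (Cmult_comm (cis _)), cis_conj; ring.
Qed.

(** The parts of the axial velocity are multiplied by -b and -a, so [dipole] depends on it linearly
    over the reals only; hence the real factor s, later 0 or a sign. *)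
Lemma dipole_inj (p1 p2 : position) (v1 v2 : velocity) (s : R) :
  dipole a b p1 v1 = (s * dipole a b p2 v2)%C ->
  axial_velocity p1 v1 = (s * axial_velocity p2 v2)%C.
Proof.
  unfold dipole; generalize (axial_velocity p1 v1) (axial_velocity p2 v2).
  intros [x1 y1] [x2 y2] H; injection H; simpl; intros Hy Hx.
  apply injective_projections; simpl.
  - apply (Rmult_eq_reg_l b); [|lra].
    apply Ropp_eq_reg; unfold Re in Hx; simpl in Hx; rewrite Hx; ring.
  - apply (Rmult_eq_reg_l a); [|lra].
    apply Ropp_eq_reg; unfold Im in Hy; simpl in Hy; rewrite Hy; ring.
Qed.

(** Vanishing coefficients force omega = 0, since ell_sum * ell_diff > 0, and a zero velocity at the
    centre, hence a zero field. *)
Lemma laurent_nonzero (p : position) (v : velocity) :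
  nonzero_velocity v -> ~ (laurent1 a b p v = 0%C /\ laurent2 a b p v = 0%C).
Proof.
  intros [z Hz] [H1 H2]; apply Hz.
  assert (S := ell_sum_pos); assert (D := ell_diff_pos).
  assert (Nc := cis_neq_0 (theta p)).
  assert (Ns : RtoC (ell_sum a b) <> 0%C)
    by (apply Cmod_gt_0; rewrite Cmod_R, Rabs_pos_eq; lra).
  unfold laurent1 in H1; unfold laurent2 in H2; rewrite RtoC_mult in H2.
  apply Cmult_integral in H1; destruct H1 as [H1|H1].
  { destruct (Cmult_neq_0 _ _ Ns Nc H1). }
  apply Cmult_integral in H2; destruct H2 as [H2|H2].
  { destruct (Cmult_neq_0 _ _ (Cmult_neq_0 _ _ Ns Ns) (Cmult_neq_0 _ _ Nc Nc) H2). }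
  rewrite (field_center p), axial_velocity_field.
  rewrite (dipole_inj p p v v 0) by (rewrite H1; ring).
  unfold quadrupole in H2; injection H2; intros Hom.
  replace (omega v) with 0; [ring|].
  apply (Rmult_eq_reg_r (ell_sum a b * ell_diff a b)); [lra|nra].
Qed.

(** The ellipse is invariant under the half-turn about its centre, which is the ambiguity left by
    e^(2 i theta). *)
Lemma same_position_of_sign (p1 p2 : position) :
  center p1 = center p2 ->
  cis (theta p1) = cis (theta p2) \/ cis (theta p1) = (- cis (theta p2))%C ->
  same_position (ellipse a b) p1 p2.
Proof.
  intros Hc He.
  assert (ell_opp : forall z, ellipse a b z -> ellipse a b (- z)%C).
  { intros [x y]; unfold ellipse; simpl; intros H.
    replace (- x * (- x * 1)) with (x * (x * 1)) by ring.
    replace (- y * (- y * 1)) with (y * (y * 1)) by ring; exact H. }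
  intros x; split; intros (z & Hz & ->); rewrite act_center.
  - destruct He as [He|He].
    + exists z; split; [exact Hz|]; rewrite act_center, Hc, He; reflexivity.
    + exists (- z)%C; split; [apply ell_opp, Hz|]; rewrite act_center, Hc, He; ring.
  - destruct He as [He|He].
    + exists z; split; [exact Hz|]; rewrite act_center, Hc, He; reflexivity.
    + exists (- z)%C; split; [apply ell_opp, Hz|]; rewrite act_center, Hc, He; ring.
Qed.

End Reconstruction.

Theorem mainTheorem2 (a b : R) (hb : 0 < b) (hab : b < a) :
  detectable (ellipse a b).
Proof.
  intros p1 p2 v1 v2 xi1 xi2 rho Hv1 _ HP1 HP2 _ Heq.
  assert (S := ell_sum_pos a b hb hab); assert (D := ell_diff_pos a b hab).
  assert (Ns : RtoC (ell_sum a b) <> 0%C)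
    by (apply Cmod_gt_0; rewrite Cmod_R, Rabs_pos_eq; lra).
  destruct (laurent_rigidity _ _ _ _ _ _ _ _ xi1 xi2 (ell_sum a b) rho
     (Rlt_le _ _ S) (focal_neq_0 a b hb hab p1) (focal_neq_0 a b hb hab p2)
     (laurent_nonzero a b hb hab p1 v1 Hv1)
     (fun eta => potential_laurent a b hb hab p1 v1 xi1 eta HP1)
     (fun eta => potential_laurent a b hb hab p2 v2 xi2 eta HP2) Heq)
    as (Hc & Hk & HA & HB).
  assert (Nc := cis_neq_0 (theta p1)).
  assert (Hsq : (cis (theta p1) * cis (theta p1) = cis (theta p2) * cis (theta p2))%C).
  { assert (N : RtoC (ell_sum a b * ell_diff a b) <> 0%C)
      by (apply Cmod_gt_0; rewrite Cmod_R, Rabs_pos_eq; nra).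
    unfold focal in Hk; apply (C_mult_cancel _ _ _ N Hk). }
  (* [laurent2] involves theta only through e^(2 i theta), already recovered, so it gives omega
     without sign ambiguity. *)
  assert (Hom : omega v1 = omega v2).
  { unfold laurent2 in HB; rewrite <- Hsq in HB; apply C_mult_cancel in HB.
    - unfold quadrupole in HB; injection HB; intros E.
      apply (Rmult_eq_reg_r (ell_sum a b * ell_diff a b)); nra.
    - rewrite RtoC_mult; repeat apply Cmult_neq_0; assumption. }
  assert (Hsign : exists s : R, (s = 1 \/ s = - (1)) /\
     (cis (theta p2) = RtoC s * cis (theta p1))%C).
  { assert (E : ((cis (theta p2) - cis (theta p1)) * (cis (theta p2) + cis (theta p1)) = 0)%C).
    { transitivity (cis (theta p2) * cis (theta p2) - cis (theta p1) * cis (theta p1))%C;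
        [|rewrite Hsq]; ring. }
    apply Cmult_integral in E; destruct E as [E|E].
    - exists 1; split; [left; reflexivity|]; apply C_minus_eq; rewrite <- E; ring.
    - exists (- (1)); split; [right; reflexivity|]; apply C_minus_eq; rewrite <- E.
      rewrite RtoC_opp; ring. }
  destruct Hsign as (s & Hs & He).
  (* As [laurent1] is the same for both, a change of sign of e^(i theta) is compensated by one of
     the axial velocity. *)
  assert (Hax : axial_velocity p1 v1 = (s * axial_velocity p2 v2)%C).
  { apply (dipole_inj a b hb hab).
    apply (C_mult_cancel (RtoC (ell_sum a b) * cis (theta p1))%C);
      [apply Cmult_neq_0; assumption|].
    unfold laurent1 in HA; rewrite HA, He; ring. }
  split.
  - apply same_position_of_sign; [exact Hc|].
    destruct Hs as [-> | ->]; rewrite He; [left|right; rewrite RtoC_opp]; ring.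
  (* The velocity of the centre is e^(i theta) times the axial velocity, so the factor s passes from
     one to the other and the fields agree. *)
  - intros z; rewrite (field_center p1 v1), (field_center p2 v2), Hc, Hom.
    rewrite <- Hc at 2.
    rewrite !axial_velocity_field, Hax, He; ring.
Qed.
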